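(* For any configuration $\mathcal{H}$ of size $h$ and any $s,k\in\mathbb{N}$ there are $r,m_0,N\in\mathbb{N}$ such that the following holds. If $m\ge m_0$, $n\ge N\log m$, and for $j\in[h]$ we have $R_j\subset[n]$ with $|R_j|\le k$ and $(r,m^{-k})$-uncapturable families $\mathcal{A}_j\subset[m]^{[n]\setminus R_j}$, then, writing $T=\bigcup_{j}R_j$, there are $x^j\in\mathcal{A}_j$ ($j\in[h]$) such that $y^j=x^j_{[n]\setminus T}$, $j\in[h]$, realise $\mathcal{H}$.
   Context: $\mu$ is the uniform probability measure on $[m]^I$. A dictator in $[m]^I$ is $\{x:x_i=a\}$ ($i\in I$, $a\in[m]$); $\mathcal{G}\subset[m]^I$ is $(r,\varepsilon)$-uncapturable if for every set of at most $r$ dictators with union $U$ we have $\mu(\mathcal{G}\setminus U)>\varepsilon$. An $\ell$-configuration is a multiset $\mathcal{H}=\{e_1,\dots,e_h\}$ of $\ell$-element edges on a finite vertex set partitioned into $U_1,\dots,U_\ell$, each edge having exactly one vertex in each part; $h=|\mathcal{H}|$ is its size. Vectors $y^1,\dots,y^h\in[m]^{I}$ realise $\mathcal{H}$ if there is an injection $\Phi:[\ell]\to I$ such that for all distinct $j,j'\in[h]$ and $i\in I$: $y^j_i=y^{j'}_i$ exactly when $i=\Phi(k)$ for some $k\in[\ell]$ with $e_j\cap e_{j'}\cap U_k\ne\emptyset$. *)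

(* Defs.v *)
From mathcomp Require Import all_boot all_order all_algebra.
From Stdlib Require Reals.
Set Implicit Arguments. Unset Strict Implicit. Unset Printing Implicit Defensive.
Import GRing.Theory Num.Theory.
Local Open Scope ring_scope.

Definition mu (I : finType) (m : nat) (G : {set {ffun I -> 'I_m}}) : rat :=
  (#|G|%:R) / ((m%:R : rat) ^+ #|I|).

Definition dictator (I : finType) (m : nat) (i : I) (a : 'I_m) : {set {ffun I -> 'I_m}} :=
  [set x : {ffun I -> 'I_m} | x i == a].

Definition dict_union (I : finType) (m : nat) (D : {set I * 'I_m}) : {set {ffun I -> 'I_m}} :=
  \bigcup_(p in D) dictator p.1 p.2.

Definition uncapturable (I : finType) (m r : nat) (eps : rat) (G : {set {ffun I -> 'I_m}}) : Prop :=
  forall D : {set I * 'I_m}, (#|D| <= r)%N -> eps < mu (G :\: dict_union D).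

(* An l-configuration of size h: vertex set V (a finite type) partitioned into
   U_0, ..., U_(l-1) via part (U_k = part^-1 k), and h edges e_0, ..., e_(h-1)
   (a multiset, given as a family indexed by 'I_h), each edge having exactly one
   vertex in each part. *)
Definition is_config (l h : nat) (V : finType) (part : V -> 'I_l) (e : 'I_h -> {set V}) : Prop :=
  forall (j : 'I_h) (k : 'I_l), #|[set v in e j | part v == k]| = 1%N.

Definition realise (l h : nat) (V : finType) (part : V -> 'I_l) (e : 'I_h -> {set V})
  (I : finType) (m : nat) (y : 'I_h -> {ffun I -> 'I_m}) : Prop :=
  exists Phi : 'I_l -> I, injective Phi /\
    forall (j j' : 'I_h), j != j' -> forall i : I,
      (y j i == y j' i) =
      [exists k : 'I_l, (i == Phi k) && ([set v in e j :&: e j' | part v == k] != set0)].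

Lemma notin_sub (n : nat) (R T : {set 'I_n}) (sRT : R \subset T) (i : 'I_n) :
  i \notin T -> i \notin R.
Proof. by apply: contra => iR; apply: (subsetP sRT). Qed.

Definition restr (n m : nat) (R T : {set 'I_n}) (sRT : R \subset T)
  (x : {ffun {i : 'I_n | i \notin R} -> 'I_m}) : {ffun {i : 'I_n | i \notin T} -> 'I_m} :=
  [ffun i => x (exist _ (val i) (notin_sub sRT (valP i)))].

Lemma R_sub_T (n h : nat) (R : 'I_h -> {set 'I_n}) (j : 'I_h) :
  R j \subset \bigcup_(j0 : 'I_h) R j0.
Proof. exact: (bigcup_sup j). Qed.

(* Main.v *)
(* Every family is first restricted to a small set of coordinates, chosen to
   maximise density against a power [K ^ |S|] with [K] a tiny power of [m]. The
   restricted family is spread: fixing further coordinates [Q] multiplies its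
   density by at most [K ^ |Q|]. Uncapturability lets the restrictions be chosen
   one after another so that no two of them share a value outside [T]. A Chernoff
   count shows that a family of density [m ^ -k] has only [O(log m)] coordinates
   with many rare values, which leaves room to plant the prescribed agreements.

   What remains is to find pairwise everywhere-disagreeing members of spread
   families. Randomly splitting every alphabet into blocks, one per family, this
   is a second moment computation whose variance is the noise stability of the
   family at noise rate about [1/m]. Global hypercontractivity for even moments
   bounds the stability at the much larger rate about [m ^ (-1/2)] up to a factor
   [m ^ (1/4)], and convexity of the stability in the rate brings the factor down
   to [1 + o(1)] at rate [1/m]. *)
Require Import Defs.
From mathcomp Require Import all_boot all_order all_algebra all_fingroup.
From mathcomp Require Import ring lra zify.
From Stdlib Require Reals Lra.
From Stdlib Require Import FunctionalExtensionality.
Set Implicit Arguments. Unset Strict Implicit. Unset Printing Implicit Defensive.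
Import Order.TTheory GRing.Theory Num.Theory.

(** The measure is rational, so the argument stays in an ordered field without roots: the integers
    [w] near m^(1/4) and [K] near m^(1/(8(l+1))) replace them, and norms are compared through their
    powers.

    Two moment inequalities are combined. The plain one holds for every function at correlation
    about m^(-1/2), the price of bounding a maximum by [m] times an average. Alone it gives
    stability at rate about 1/m up to a factor m^(1/4); this is already the target rate, so
    convexity has no room to act. The global one works at constant correlation but leaves Laplacian
    terms, which spreadness bounds. Their composition reaches rate m^(-1/2), and convexity then
    interpolates with weight about m^(-1/2), which beats m^(1/4).

    Clashes between restrictions are removed in two ways. If both coordinates are restricted, the
    family chosen later avoids the earlier values by uncapturability. If one is restricted and the
    other free, the free one avoids the value once all restrictions are known, by spreadness. *)

(** * Integer parameters in place of roots and logarithms *)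

Lemma fourth_root_bounds m w0 : (w0.+1 ^ 4 <= m)%N ->
  exists w, [/\ (w0 < w)%N, (w ^ 4 <= m)%N, (m < w.+1 ^ 4)%N & (m <= 16 * w ^ 4)%N].
Proof.
move=> wm.
have ub i : (i ^ 4 <= m)%N -> (i <= m)%N.
  by case: i => // i; apply: leq_trans; rewrite -{1}[i.+1]expn1 leq_pexp2l.
have [w wP wmax] := ex_maxnP (ex_intro (fun i => (i ^ 4 <= m)%N) _ wm) ub.
have w0w := wmax _ wm; exists w.
have mw : (m < w.+1 ^ 4)%N by rewrite ltnNge; apply/negP => /wmax; rewrite ltnn.
split=> //; apply: leq_trans (ltnW mw) _.
rewrite -[16%N]/(2 ^ 4)%N -expnMn leq_exp2r // mul2n -addnn -addn1 leq_add2l.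
exact: leq_ltn_trans w0w.
Qed.

(** [K] is the least integer with m <= K^(8(l+1)), so K^(l+1) is about m^(1/8) while [w] is about
    m^(1/4). The gap absorbs 2 * 16^l, the density lost later by avoiding and planting. *)
Lemma root_choice l m w : (2 <= m)%N -> (m < w.+1 ^ 4)%N ->
  ((2 * 16 ^ l) ^ 8 * 2 ^ (8 * l.+1) <= m)%N ->
  exists K, [/\ (0 < K)%N, (m <= K ^ (8 * l.+1))%N & (2 * 16 ^ l * K ^ l.+1 <= w)%N].
Proof.
move=> m2 mw big; set c0 := (8 * l.+1)%N in big *.
have c00 : (0 < c0)%N by rewrite muln_gt0.
have exK : exists K, (m <= K ^ c0)%N by exists m; rewrite -{1}[m]expn1 leq_pexp2l //; lia.
have [K KP Kmin] := ex_minnP exK; exists K.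
have K2 : (2 <= K)%N.
  case: K KP {Kmin} => [|[|//]]; first by rewrite exp0n //; lia.
  by rewrite exp1n; lia.
split=> //; first by lia.
have Kpred : (K.-1 ^ c0 < m)%N.
  by rewrite ltnNge; apply/negP => /Kmin; case: (K) K2 => // K' _; rewrite ltnn.
have K2c : (K ^ c0 <= 2 ^ c0 * K.-1 ^ c0)%N.
  by rewrite -expnMn leq_exp2r //; lia.
rewrite leqNgt; apply/negP; set X := (_ * _)%N => wX.
have mX : (m < X ^ 4)%N by apply: leq_trans mw _; rewrite leq_exp2r.
have X8 : (m * m < X ^ 8)%N.
  by rewrite -[8%N]/(4 + 4)%N expnD ltn_mul.
move: X8; rewrite /X expnMn -expnM [(l.+1 * 8)%N]mulnC -/c0 ltnNge => /negP; apply.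
apply: leq_trans (leq_mul big (leqnn m)).
rewrite -mulnA leq_mul2l; apply/orP; right; apply: leq_trans K2c _.
by rewrite leq_mul2l (ltnW Kpred) orbT.
Qed.

Local Notation two := (Rdefinitions.IZR (BinNums.Zpos (BinNums.xO BinNums.xH))).

Lemma INR_expn2 a : Raxioms.INR (2 ^ a) = Rpow_def.pow two a.
Proof.
elim: a => [|a IH]; first by rewrite expn0.
by rewrite expnS -multE RIneq.mult_INR IH.
Qed.

(** Write [up_log 2 m] as t + 1. From 2^t < m and ln 2 > 1/2 one gets t <= 2 ln m, and t >= 1, where
    m > 2 enters, gives t + 1 <= 2t; hence the factor 4. *)
Lemma up_log_le_of_ln m n N : (2 < m)%N ->
  Rdefinitions.Rle (Rdefinitions.Rmult (Raxioms.INR (4 * N)) (Rpower.ln (Raxioms.INR m)))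
    (Raxioms.INR n) -> (N * up_log 2 m <= n)%N.
Proof.
move=> m2 H; have /andP[lt_m le_m] := up_log_bounds (isT : (1 < 2)%N) (ltnW m2).
have t2 : (2 <= up_log 2 m)%N.
  by rewrite leqNgt ltnS; apply/negP => t1; move: le_m; rewrite leqNgt (leq_ltn_trans _ m2) // (leq_pexp2l _ t1).
move: lt_m t2 {le_m}; case: (up_log 2 m) => // t lt_m t1; rewrite /= in lt_m.
have Rt : Rdefinitions.Rle (Rdefinitions.Rdiv (Raxioms.INR t) two) (Rpower.ln (Raxioms.INR m)).
  have p0 : Rdefinitions.Rlt (Rdefinitions.IZR BinNums.Z0) two by Lra.lra.
  have := Rpower.ln_increasing _ _ (RIneq.Rlt_le_trans _ _ _ (Rfunctions.pow_lt _ t p0) (RIneq.Rle_refl _)).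
  move=> /(_ (Raxioms.INR m)); rewrite -INR_expn2 => /(_ (RIneq.lt_INR _ _ (ssrnat.ltP lt_m))).
  rewrite INR_expn2 Rpower.ln_pow // => L.
  have := Rpower.ln_lt_2; have := RIneq.pos_INR t => t0 l2.
  have := RIneq.Rmult_le_compat_l _ _ _ t0 (RIneq.Rlt_le _ _ l2).
  Lra.lra.
apply/ssrnat.leP; apply: RIneq.INR_le; apply: RIneq.Rle_trans H.
have N0 := RIneq.pos_INR N.
have E : (Raxioms.INR (4 * N) = Rdefinitions.Rmult (Rdefinitions.IZR (BinNums.Zpos (BinNums.xO (BinNums.xO BinNums.xH)))) (Raxioms.INR N)).
  by rewrite -multE RIneq.mult_INR /=; Lra.lra.
have t1R : Rdefinitions.Rle (Rdefinitions.IZR (BinNums.Zpos BinNums.xH)) (Raxioms.INR t).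
  by have := RIneq.le_INR 1 t (@ssrnat.leP 1 t t1).
rewrite E -multE RIneq.mult_INR RIneq.S_INR.
have := RIneq.Rmult_le_compat_l _ _ _ N0 Rt.
have := RIneq.Rmult_le_compat_l _ _ _ N0 t1R.
Lra.lra.
Qed.

Local Open Scope ring_scope.

(** * Averages over sets of coordinates *)

Section Averaging.
Variables (R : realFieldType) (I : finType) (m : nat).
Hypothesis m_gt0 : (0 < m)%N.
Local Notation cube := {ffun I -> 'I_m}.
Implicit Types (A B Q : {set I}) (x y z : cube) (f g h : cube -> R).

(** Averages over [A] sample a full string [y] and read only its part in [A], so they remain
    functions on the same cube and compose without subcubes. *)
Definition overwrite A x y : cube := [ffun i => if i \in A then y i else x i].

(* Locked because rewriting would otherwise see through the averages as products. *)
Fact av_key : unit. Proof. by []. Qed.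

Definition av A f x : R :=
  locked_with av_key (#|{: cube}|%:R^-1 * \sum_y f (overwrite A x y)).

Definition mean f : R := locked_with av_key (#|{: cube}|%:R^-1 * \sum_y f y).

Lemma avE A f x : av A f x = #|{: cube}|%:R^-1 * \sum_y f (overwrite A x y).
Proof. by rewrite /av unlock. Qed.

Lemma mean_sum f : mean f = #|{: cube}|%:R^-1 * \sum_y f y.
Proof. by rewrite /mean unlock. Qed.

Lemma card_cube_neq0 : #|{: cube}|%:R != 0 :> R.
Proof. by rewrite pnatr_eq0 card_ffun card_ord -lt0n expn_gt0 m_gt0. Qed.

Lemma card_cube_gt0 : 0 < #|{: cube}|%:R :> R.
Proof. by rewrite lt0r card_cube_neq0 ler0n. Qed.

Lemma overwrite_overwrite A B x y z :
  overwrite B (overwrite A x y) z = overwrite (A :|: B) x (overwrite B y z).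
Proof.
apply/ffunP=> i; rewrite !ffunE inE.
by case: (i \in A); case: (i \in B).
Qed.

Lemma overwrite0 x y : overwrite set0 x y = x.
Proof. by apply/ffunP=> i; rewrite ffunE inE. Qed.

Lemma overwriteT x y : overwrite setT x y = y.
Proof. by apply/ffunP=> i; rewrite ffunE inE. Qed.

(** Exchanging two strings on [B] is an involution of pairs, so the first component of the exchanged
    pair is again uniform. *)
Lemma sum_overwrite B (F : cube -> R) :
  \sum_y \sum_z F (overwrite B y z) = #|{: cube}|%:R * \sum_w F w.
Proof.
pose sw (p : cube * cube) := (overwrite B p.1 p.2, overwrite B p.2 p.1).
have swK : involutive sw.
  move=> [y z]; rewrite /sw /=; congr (_, _); apply/ffunP=> i; rewrite !ffunE.
    by case: ifP => //= ->.
  by case: ifP => //= ->.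
rewrite pair_big /= (reindex_inj (inv_inj swK)) /=.
under eq_bigr => p _ do rewrite -[overwrite B _ _]/((sw (sw p)).1) swK.
rewrite -(pair_big xpredT xpredT (fun y z => F y)) /=.
by under eq_bigr => y _ do rewrite sumr_const -mulr_natl; rewrite -mulr_sumr.
Qed.

Lemma meanE f x : mean f = av setT f x.
Proof. by rewrite mean_sum avE; congr (_ * _); apply: eq_bigr => y _; rewrite overwriteT. Qed.

Lemma avT f : av setT f = fun _ => mean f.
Proof. by apply: functional_extensionality => x; rewrite (meanE f x). Qed.

Lemma av_av A B f : av A (av B f) = av (A :|: B) f.
Proof.
apply: functional_extensionality => x; rewrite !avE; under eq_bigr => y _ do rewrite avE; rewrite -mulr_sumr; congr (_ * _).
under eq_bigr => y _ do under eq_bigr => z _ do rewrite overwrite_overwrite.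
by rewrite (sum_overwrite B (fun w => f (overwrite (A :|: B) x w))) mulrA mulVf ?mul1r // card_cube_neq0.
Qed.

Lemma avC A B f : av A (av B f) = av B (av A f).
Proof. by rewrite !av_av setUC. Qed.

Lemma av_id A f : av A (av A f) = av A f.
Proof. by rewrite av_av setUid. Qed.

Lemma mean_av A f : mean (av A f) = mean f.
Proof.
pose x : cube := [ffun=> Ordinal m_gt0].
by rewrite (meanE _ x) av_av setTU -meanE.
Qed.

Lemma av_overwrite A f x y : av A f (overwrite A x y) = av A f x.
Proof.
rewrite !avE; congr (_ * _); apply: eq_bigr => z _; rewrite overwrite_overwrite setUid.
by congr (f _); apply/ffunP=> i; rewrite !ffunE; case: (i \in A).
Qed.

Lemma avD A f g : av A (fun x => f x + g x) = fun x => av A f x + av A g x.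
Proof.
by apply: functional_extensionality => x; rewrite !avE big_split mulrDr.
Qed.

Lemma avZ A a f : av A (fun x => a * f x) = fun x => a * av A f x.
Proof.
apply: functional_extensionality => x.
by rewrite !avE -mulr_sumr mulrCA.
Qed.

Lemma av_cst A (a : R) : av A (fun=> a) = fun=> a.
Proof.
apply: functional_extensionality => x.
by rewrite avE /= sumr_const -[a *+ _]mulr_natl mulrA mulVf ?mul1r // card_cube_neq0.
Qed.

Lemma avB A f g : av A (fun x => f x - g x) = fun x => av A f x - av A g x.
Proof.
apply: functional_extensionality => x.
by rewrite !avE -mulrBr; congr (_ * _); rewrite -sumrB.
Qed.

Lemma av_le A f g x : (forall y, f y <= g y) -> av A f x <= av A g x.
Proof.
by move=> fg; rewrite !avE ler_wpM2l ?invr_ge0 ?ler0n //; apply: ler_sum => y _.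
Qed.

Lemma av_ge0 A f x : (forall y, 0 <= f y) -> 0 <= av A f x.
Proof. by move=> f0; rewrite -[0](congr1 (fun F => F x) (av_cst A 0)) av_le. Qed.

Lemma mean_le f g : (forall y, f y <= g y) -> mean f <= mean g.
Proof.
by move=> fg; rewrite !mean_sum ler_wpM2l ?invr_ge0 ?ler0n //; apply: ler_sum => y _.
Qed.

Lemma mean_ge0 f : (forall y, 0 <= f y) -> 0 <= mean f.
Proof. by move=> f0; rewrite mean_sum mulr_ge0 ?invr_ge0 ?ler0n ?sumr_ge0. Qed.

Lemma meanD f g : mean (fun x => f x + g x) = mean f + mean g.
Proof. by rewrite !mean_sum big_split mulrDr. Qed.

Lemma meanB f g : mean (fun x => f x - g x) = mean f - mean g.
Proof. by rewrite !mean_sum sumrB mulrBr. Qed.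

Lemma meanZ a f : mean (fun x => a * f x) = a * mean f.
Proof. by rewrite !mean_sum -mulr_sumr mulrCA. Qed.

Lemma mean_bigsum (J : finType) (F : J -> cube -> R) :
  mean (fun x => \sum_j F j x) = \sum_j mean (F j).
Proof.
rewrite mean_sum exchange_big mulr_sumr.
by apply: eq_bigr => j _; rewrite mean_sum.
Qed.

Lemma mean_cst (a : R) : mean (fun=> a) = a.
Proof. by rewrite !mean_sum sumr_const -[a *+ _]mulr_natl mulrA mulVf ?mul1r // card_cube_neq0. Qed.

Lemma av_norm A f x : `|av A f x| <= av A (fun y => `|f y|) x.
Proof.
rewrite !avE normrM ger0_norm ?invr_ge0 ?ler0n // ler_wpM2l ?invr_ge0 ?ler0n //.
exact: ler_norm_sum.
Qed.

Lemma av_pull A f g : av A (fun x => av A f x * g x) = fun x => av A f x * av A g x.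
Proof.
apply: functional_extensionality => x.
rewrite [LHS]avE [av A g x]avE mulrCA; congr (_ * _); rewrite mulr_sumr.
by apply: eq_bigr => y _; rewrite av_overwrite.
Qed.

(** The condition [av A f = f] is how independence of the coordinates in [A] is expressed. *)
Lemma av_indep A f g : av A f = f ->
  av A (fun x => f x * g x) = fun x => f x * av A g x.
Proof. by move=> Af; have := av_pull A f g; rewrite Af. Qed.

Lemma av_comp A f (F : R -> R) : av A f = f -> av A (fun x => F (f x)) = fun x => F (f x).
Proof.
move=> Af; apply: functional_extensionality => x; rewrite avE -Af.
under eq_bigr => y _ do rewrite av_overwrite.
by rewrite sumr_const -[F _ *+ _]mulr_natl mulrA mulVf ?mul1r // card_cube_neq0.
Qed.

Lemma av_sym A B f g : B \subset A ->
  av A (fun x => av B f x * g x) = av A (fun x => f x * av B g x).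
Proof.
move=> /setUidPl AB; rewrite -[in LHS]AB -[in RHS]AB -!av_av av_pull; congr (av A _).
rewrite [X in _ = av B X](_ : _ = fun x => av B g x * f x); last first.
  by apply: functional_extensionality => y; rewrite mulrC.
by rewrite av_pull; apply: functional_extensionality => x; rewrite mulrC.
Qed.

(** The discriminant criterion, by evaluation at the vertex [- b / a]; it yields Cauchy-Schwarz
    without square roots. *)
Lemma nonneg_quadratic (a b c : R) : 0 <= a ->
  (forall t, 0 <= a * t ^+ 2 + 2 * b * t + c) -> b ^+ 2 <= a * c.
Proof.
move=> a0 H; have [->|an0] := eqVneq b 0.
  by rewrite expr0n /= mulr_ge0 //; have := H 0; rewrite expr0n /= !mulr0 !add0r.
have [a00|a1] := eqVneq a 0.
  have := H (- (c + 1) / (2 * b)); rewrite a00.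
  have -> : 0 * (- (c + 1) / (2 * b)) ^+ 2 + 2 * b * (- (c + 1) / (2 * b)) + c = -1.
    by field.
  by rewrite oppr_ge0 ler10.
have := H (- b / a).
have -> : a * (- b / a) ^+ 2 + 2 * b * (- b / a) + c = (a * c - b ^+ 2) / a by field.
by rewrite ler_pdivlMr ?lt0r ?a1 // mul0r subr_ge0.
Qed.

Lemma av_CS A f g x :
  (av A (fun y => f y * g y) x) ^+ 2
    <= av A (fun y => f y ^+ 2) x * av A (fun y => g y ^+ 2) x.
Proof.
apply: nonneg_quadratic => [|t]; first by apply: av_ge0 => y; exact: sqr_ge0.
have -> : av A (fun y => f y ^+ 2) x * t ^+ 2 + 2 * av A (fun y => f y * g y) x * t
   + av A (fun y => g y ^+ 2) x = av A (fun y => (t * f y + g y) ^+ 2) x.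
  have -> : (fun y => (t * f y + g y) ^+ 2) =
     (fun y => t ^+ 2 * f y ^+ 2 + (2 * t * (f y * g y) + g y ^+ 2)).
    by apply: functional_extensionality => y; ring.
  by rewrite avD avZ avD avZ; ring.
by apply: av_ge0 => y; exact: sqr_ge0.
Qed.

Lemma av_sqr_le A f x : av A f x ^+ 2 <= av A (fun y => f y ^+ 2) x.
Proof.
have := av_CS A f (fun=> 1) x.
rewrite [X in _ <= _ * X -> _](_ : _ = 1) ?mulr1; last first.
  by have := av_cst A (1 ^+ 2); rewrite expr1n => ->.
by under [X in av A X]functional_extensionality => y do rewrite mulr1.
Qed.

Lemma av0 f : av set0 f = f.
Proof.
apply: functional_extensionality => x; rewrite !avE.
under eq_bigr => y _ do rewrite overwrite0.
by rewrite sumr_const -[f x *+ _]mulr_natl mulrA mulVf ?mul1r // card_cube_neq0.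
Qed.

Lemma mean_prod (phi : I -> 'I_m -> R) :
  mean (fun z => \prod_i phi i (z i)) = \prod_i (m%:R^-1 * \sum_a phi i a).
Proof.
rewrite big_split /= mean_sum prodr_const card_ffun card_ord natrX exprVn.
by rewrite bigA_distr_bigA.
Qed.

Lemma mean_eq i a : mean (fun z => (z i == a)%:R) = m%:R^-1.
Proof.
have -> : (fun z : cube => (z i == a)%:R : R) =
    (fun z => \prod_j (if j == i then (z j == a)%:R else 1)).
  apply: functional_extensionality => z.
  by rewrite (bigD1 i) //= eqxx big1 ?mulr1 // => j /negPf ->.
have mR : m%:R != 0 :> R by rewrite pnatr_eq0 -lt0n.
rewrite (mean_prod (fun j b => if j == i then (b == a)%:R else 1)).
rewrite (bigD1 i) //= eqxx -[RHS]mulr1; congr (_ * _).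
  by rewrite (bigD1 a) //= eqxx big1 ?addr0 ?mulr1 // => b /negPf ->.
apply: big1 => j /negPf ->.
by rewrite sumr_const card_ord mulVf.
Qed.

Definition upd x i a : cube := [ffun j => if j == i then a else x j].

Lemma av1E i f x : av [set i] f x = m%:R^-1 * \sum_a f (upd x i a).
Proof.
have E z : f (overwrite [set i] x z) = \sum_a (z i == a)%:R * f (upd x i a).
  rewrite (bigD1 (z i)) //= eqxx mul1r big1 ?addr0.
    congr (f _); apply/ffunP=> j; rewrite !ffunE inE.
    by case: eqP => // ->.
  by move=> a; rewrite eq_sym => /negPf ->; rewrite mul0r.
rewrite !avE (eq_bigr _ (fun z _ => E z)) exchange_big /= !mulr_sumr.
apply: eq_bigr => a _; rewrite -mulr_suml mulrA; congr (_ * _).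
by rewrite -(mean_eq i a) mean_sum.
Qed.

Lemma le_card_av1 i f x : (forall y, 0 <= f y) -> f x <= m%:R * av [set i] f x.
Proof.
move=> f0; rewrite av1E mulrA divff ?pnatr_eq0 -?lt0n // mul1r (bigD1 (x i)) //=.
rewrite [X in f X <= _](_ : x = upd x i (x i)) ?lerDl ?sumr_ge0 //.
by apply/ffunP=> j; rewrite ffunE; case: eqP => // ->.
Qed.

End Averaging.

(** * Power inequalities *)

Section PowerInequalities.
Variable R : realFieldType.
Implicit Types (a b c t X Y : R).

(** The larger of [a] and [Y] may replace the other, so in the expansion below only the two extreme
    monomials have to be kept. *)
Lemma mixed_power_le p j a Y : 0 <= a -> 0 <= Y -> (j <= p)%N ->
  a ^+ (p - j) * Y ^+ j.+1 <= a ^+ p * Y + Y ^+ p.+1.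
Proof.
move=> a0 Y0 jp; have [aY|/ltW Ya] := leP a Y.
  have: a ^+ (p - j) * Y ^+ j.+1 <= Y ^+ (p - j) * Y ^+ j.+1.
    by rewrite ler_wpM2r ?exprn_ge0 // lerXn2r.
  by rewrite -exprD addnS subnK // => /le_trans -> //; rewrite lerDr mulr_ge0 ?exprn_ge0.
have: a ^+ (p - j) * Y ^+ j.+1 <= a ^+ (p - j) * (a ^+ j * Y).
  by rewrite ler_wpM2l ?exprn_ge0 // exprSr ler_wpM2r // lerXn2r.
by rewrite mulrA -exprD subnK // => /le_trans -> //; rewrite lerDl exprn_ge0.
Qed.

(* The linear term in [X] has mean zero where this is applied, so only the
   terms in [Y], which carry the square of the noise parameter, survive. *)
Lemma power_expansion_le p : exists2 C : nat, (0 < C)%N &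
  forall a X Y, 0 <= a -> 0 <= Y -> X ^+ 2 <= 4 * a * Y ->
  (a + X + Y) ^+ p.+1 <=
    a ^+ p.+1 + p.+1%:R * a ^+ p * X + C%:R * (a ^+ p * Y + Y ^+ p.+1).
Proof.
elim: p => [|p [C C0 IH]].
  by exists 1%N => // a X Y a0 Y0 _; rewrite !expr1 expr0; lra.
exists (6 * C + 6 * p.+1 + 1)%N => [|a X Y a0 Y0 X2]; first by rewrite addn1.
(* Since 4aY <= (a + Y)^2, the hypothesis becomes a linear bound on [X]; the base [a + X + Y] is
   then nonnegative and at most 2(a + Y). *)
have XaY : `|X| <= a + Y.
  rewrite -ler_sqr ?nnegrE ?addr_ge0 // real_normK ?num_real //.
  by apply: le_trans X2 _; rewrite -subr_ge0 [X in 0 <= X](_ : _ = (a - Y) ^+ 2) ?sqr_ge0 //; ring.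
have [XlA XgA] : X <= a + Y /\ - (a + Y) <= X.
  by move: XaY; rewrite ler_norml => /andP[].
have s0 : 0 <= a + X + Y by lra.
have := IH a X Y a0 Y0 X2 => /(ler_wpM2r s0); rewrite -exprSr => /le_trans; apply.
have m0 := mixed_power_le a0 Y0 (leq0n p.+1).
have m1 := @mixed_power_le p.+1 1 a Y a0 Y0 isT.
have mp := mixed_power_le a0 Y0 (leqnSn p).
rewrite ?subn0 subSS subn0 subSnn expr1 in m0 m1 mp.
have ap : 0 <= a ^+ p by rewrite exprn_ge0.
have Yp : 0 <= Y ^+ p.+1 by rewrite exprn_ge0.
have CR : 0 <= C%:R :> R by rewrite ler0n.
have pR : 0 <= p.+1%:R :> R by rewrite ler0n.
have E1 : p.+1%:R * a ^+ p * X ^+ 2 <= p.+1%:R * (4 * (a ^+ p.+1 * Y)).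
  rewrite -mulrA ler_wpM2l //; apply: le_trans (ler_wpM2l ap X2) _.
  by rewrite le_eqVlt; apply/orP; left; apply/eqP; rewrite (exprS a); ring.
have E2 : p.+1%:R * a ^+ p * X * Y <= p.+1%:R * (a ^+ p.+1 * Y + (a ^+ p.+1 * Y + Y ^+ p.+2)).
  rewrite -!mulrA ler_wpM2l //; apply: (@le_trans _ _ (a ^+ p * ((a + Y) * Y))).
    by rewrite ler_wpM2l // ler_wpM2r.
  rewrite [X in X <= _](_ : _ = a ^+ p.+1 * Y + a ^+ p * Y ^+ 2) ?lerD2l //.
  by rewrite (exprS a); ring.
have E3 : C%:R * (a ^+ p * Y + Y ^+ p.+1) * (a + X + Y)
    <= C%:R * (2 * (3 * (a ^+ p.+1 * Y) + 3 * Y ^+ p.+2)).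
  rewrite -mulrA ler_wpM2l //.
  apply: (@le_trans _ _ ((a ^+ p * Y + Y ^+ p.+1) * (2 * (a + Y)))).
    by apply: ler_wpM2l; [rewrite addr_ge0 ?mulr_ge0|lra].
  rewrite [X in X <= _](_ : _ = 2 * (a ^+ p.+1 * Y + a ^+ p * Y ^+ 2 + a * Y ^+ p.+1 + Y ^+ p.+2)).
    by rewrite ler_wpM2l //; lra.
  by rewrite !(exprS a) !(exprS Y); ring.
have aY0 : 0 <= a ^+ p.+1 * Y by rewrite mulr_ge0 ?exprn_ge0.
have YY0 : 0 <= Y ^+ p.+2 by rewrite exprn_ge0.
rewrite [X in X <= _](_ : _ = a ^+ p.+2 + p.+2%:R * a ^+ p.+1 * X
   + (a ^+ p.+1 * Y + p.+1%:R * a ^+ p * X ^+ 2 + p.+1%:R * a ^+ p * X * Y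
   + C%:R * (a ^+ p * Y + Y ^+ p.+1) * (a + X + Y))); last first.
  by rewrite -(natr1 p.+1) !(exprS a) ?(exprS c) ?(exprS Y); ring.
rewrite lerD2l.
rewrite natrD natrD natrM natrM mulr1n.
set P := p.+1%:R in pR E1 E2 *; set D := C%:R in CR E3 *.
set U := a ^+ p.+1 * Y in aY0 E1 E2 E3 *; set W := Y ^+ p.+2 in YY0 E2 E3 *.
have PW : 0 <= P * W by rewrite mulr_ge0.
have PU : 0 <= P * U by rewrite mulr_ge0.
have -> : (6 * D + 6 * P + 1) * (U + W) = 6 * (D * (U + W)) + 6 * (P * U) + 6 * (P * W) + U + W by ring.
lra.
Qed.

Lemma power_superadd p a b : 0 <= a -> 0 <= b ->
  a ^+ p.+1 + b ^+ p.+1 <= (a + b) ^+ p.+1.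
Proof.
move=> a0 b0; elim: p => [|p IH]; first by rewrite !expr1.
rewrite [X in _ <= X]exprS; apply: le_trans (ler_wpM2l (addr_ge0 a0 b0) IH).
rewrite -subr_ge0 [X in 0 <= X](_ : _ = a * b ^+ p.+1 + b * a ^+ p.+1).
  by rewrite addr_ge0 ?mulr_ge0 ?exprn_ge0.
by rewrite (exprS a p.+1) (exprS b p.+1); ring.
Qed.

(** Used with [a] the energy of the average in one coordinate and [b] that of the Laplacian: the
    left side is what the moment steps produce. *)
Lemma power_add_ge p a b : 0 <= a -> 0 <= b ->
  a ^+ p.+2 + a ^+ p.+1 * b + b ^+ p.+2 <= (a + b) ^+ p.+2.
Proof.
move=> a0 b0; rewrite [X in _ <= X]exprS.
apply: le_trans (ler_wpM2l (addr_ge0 a0 b0) (power_superadd p a0 b0)).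
rewrite -subr_ge0 [X in 0 <= X](_ : _ = a * b ^+ p.+1).
  by rewrite mulr_ge0 ?exprn_ge0.
by rewrite (exprS a p.+1) (exprS b p.+1); ring.
Qed.

Lemma power_tangent p a c : 0 <= a -> 0 <= c ->
  c ^+ p.+1 + p.+1%:R * c ^+ p * (a - c) <= a ^+ p.+1.
Proof.
move=> a0 c0; elim: p => [|p IH]; first by rewrite !expr1 expr0; lra.
rewrite [X in _ <= X]exprS; apply: le_trans (ler_wpM2l a0 IH).
rewrite -subr_ge0 [X in 0 <= X](_ : _ = p.+1%:R * c ^+ p * (a - c) ^+ 2).
  by rewrite mulr_ge0 ?sqr_ge0 // mulr_ge0 ?exprn_ge0 // ler0n.
by rewrite -(natr1 p.+1) !(exprS c); ring.
Qed.

End PowerInequalities.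

(** * Noise operators and moment bounds *)

Section Noise.
Variables (R : realFieldType) (I : finType) (m : nat).
Hypothesis m_gt0 : (0 < m)%N.
Local Notation cube := {ffun I -> 'I_m}.
Local Notation avC := (avC (R := R) (I := I) m_gt0).
Local Notation av_cst := (av_cst (R := R) (I := I) m_gt0).
Implicit Types (A B Q : {set I}) (x y z : cube) (f g h : cube -> R) (i j : I)
  (s t : seq I) (rho : R).

(** [rho] is the probability of keeping coordinate [i], which is otherwise resampled: a small [rho]
    is a strong noise, and the rates are values of [rho]. *)
Definition noise1 rho i f : cube -> R :=
  fun x => rho * f x + (1 - rho) * av [set i] f x.
(** The Efron-Stein component of [f] that genuinely depends on coordinate [i]. *)
Definition lap i f : cube -> R := fun x => f x - av [set i] f x.
Definition noise rho s f := foldr (noise1 rho) f s.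

Lemma avLin A a b f g : av A (fun x => a * f x + b * g x) = fun x => a * av A f x + b * av A g x.
Proof. by rewrite avD !avZ. Qed.

Lemma av_noise1 A rho i f : av A (noise1 rho i f) = noise1 rho i (av A f).
Proof. by rewrite avLin avC. Qed.

Lemma av_noise A rho s f : av A (noise rho s f) = noise rho s (av A f).
Proof. by elim: s => //= i s IH; rewrite av_noise1 IH. Qed.

Lemma av_lap A i f : av A (lap i f) = lap i (av A f).
Proof. by rewrite avB avC. Qed.

Lemma noise1_lap rho i j f : noise1 rho i (lap j f) = lap j (noise1 rho i f).
Proof.
apply: functional_extensionality => x.
by rewrite /noise1 av_lap /lap avLin avC; ring.
Qed.

Lemma noise_lap rho s j f : noise rho s (lap j f) = lap j (noise rho s f).
Proof. by elim: s => //= i s IH; rewrite IH noise1_lap. Qed.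

Lemma noise1C rho rho' i j f :
  noise1 rho i (noise1 rho' j f) = noise1 rho' j (noise1 rho i f).
Proof.
apply: functional_extensionality => x.
by rewrite /noise1 !avLin avC; ring.
Qed.

Lemma noise1_noise rho rho' i s f :
  noise1 rho i (noise rho' s f) = noise rho' s (noise1 rho i f).
Proof. by elim: s => //= j s IH; rewrite noise1C IH. Qed.

Lemma noise_noise rho rho' s f : noise rho s (noise rho' s f) = noise (rho * rho') s f.
Proof.
elim: s f => //= i s IH f; rewrite -noise1_noise IH.
apply: functional_extensionality => x.
by rewrite /noise1 avLin (av_id m_gt0); ring.
Qed.

(** The Laplacian kills the averaged part. The resulting powers of [rho] later pay for the powers of
    the spread constant. *)
Lemma lap_noise1 rho i f : lap i (noise1 rho i f) = fun x => rho * lap i f x.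
Proof.
apply: functional_extensionality => x.
by rewrite /noise1 /lap avLin (av_id m_gt0); ring.
Qed.

Lemma noise1Z rho i a f : noise1 rho i (fun x => a * f x) = fun x => a * noise1 rho i f x.
Proof. by apply: functional_extensionality => x; rewrite /noise1 avZ; ring. Qed.

Lemma noiseZ rho s a f : noise rho s (fun x => a * f x) = fun x => a * noise rho s f x.
Proof. by elim: s => //= i s ->; rewrite noise1Z. Qed.

Lemma noise1_le rho i f g x : 0 <= rho <= 1 -> (forall y, f y <= g y) ->
  noise1 rho i f x <= noise1 rho i g x.
Proof.
case/andP=> r0 r1 fg; apply: lerD; first by rewrite ler_wpM2l.
by rewrite ler_wpM2l ?subr_ge0 // av_le.
Qed.

Lemma noise_le rho s f g x : 0 <= rho <= 1 -> (forall y, f y <= g y) ->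
  noise rho s f x <= noise rho s g x.
Proof.
move=> r01; elim: s f g x => //= i s IH f g x fg.
by apply: noise1_le => // y; exact: IH.
Qed.

Lemma noise1_norm rho i f x : 0 <= rho <= 1 ->
  `|noise1 rho i f x| <= noise1 rho i (fun y => `|f y|) x.
Proof.
case/andP=> r0 r1; apply: le_trans (ler_normD _ _) _.
rewrite (normrM rho) (normrM (1 - rho)) (ger0_norm r0) (@ger0_norm _ (1 - rho)) ?subr_ge0 //.
by rewrite lerD2l ler_wpM2l ?subr_ge0 // av_norm.
Qed.

Lemma noise_norm rho s f x : 0 <= rho <= 1 ->
  `|noise rho s f x| <= noise rho s (fun y => `|f y|) x.
Proof.
move=> r01; elim: s x => //= i s IH x.
apply: le_trans (noise1_norm _ _ _ r01) _.
by apply: noise1_le => // y; exact: IH.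
Qed.

Lemma noise_cst rho s (a : R) : noise rho s (fun=> a) = fun=> a.
Proof.
elim: s => //= i s ->; apply: functional_extensionality => x.
by rewrite /noise1 av_cst; ring.
Qed.

Lemma noise_ge0 rho s f x : 0 <= rho <= 1 -> (forall y, 0 <= f y) -> 0 <= noise rho s f x.
Proof.
move=> r01 f0; rewrite -[0](congr1 (fun F => F x) (noise_cst rho s 0)).
exact: noise_le.
Qed.

Lemma noise1_sym rho A i f g : i \in A ->
  av A (fun x => noise1 rho i f x * g x) = av A (fun x => f x * noise1 rho i g x).
Proof.
move=> iA.
have -> : (fun x => noise1 rho i f x * g x) =
    (fun x => rho * (f x * g x) + (1 - rho) * (av [set i] f x * g x)).
  by apply: functional_extensionality => x; rewrite /noise1; ring.
have -> : (fun x => f x * noise1 rho i g x) =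
    (fun x => rho * (f x * g x) + (1 - rho) * (f x * av [set i] g x)).
  by apply: functional_extensionality => x; rewrite /noise1; ring.
by rewrite !avLin (av_sym m_gt0 _ _ (B := [set i])) // sub1set.
Qed.

Lemma noise_sym rho A s f g : {subset s <= A} ->
  av A (fun x => noise rho s f x * g x) = av A (fun x => f x * noise rho s g x).
Proof.
elim: s f g => //= i s IH f g sA.
rewrite noise1_sym ?sA ?mem_head // IH -?noise1_noise // => j js.
by rewrite sA // inE js orbT.
Qed.

Lemma lap_split rho i g : noise1 rho i g = fun x => av [set i] g x + rho * lap i g x.
Proof. by apply: functional_extensionality => x; rewrite /noise1 /lap; ring. Qed.

Lemma av_mul_lap i f g : av [set i] (fun x => av [set i] f x * lap i g x) = fun=> 0.
Proof.
rewrite (av_pull) av_lap /lap (av_id m_gt0).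
by apply: functional_extensionality => x; rewrite subrr mulr0.
Qed.

Lemma energy_split A i g x :
  av [set i] (av A (fun y => g y ^+ 2)) x =
  av A (fun y => av [set i] g y ^+ 2) x + av [set i] (av A (fun y => lap i g y ^+ 2)) x.
Proof.
rewrite avC.
have -> : av [set i] (fun y => g y ^+ 2) =
    (fun y => av [set i] g y ^+ 2 + av [set i] (fun z => lap i g z ^+ 2) y).
  have -> : (fun y => g y ^+ 2) = (fun y => av [set i] g y ^+ 2 +
       (2 * (av [set i] g y * lap i g y) + lap i g y ^+ 2)).
    by apply: functional_extensionality => y; rewrite /lap; ring.
  rewrite avD (av_comp m_gt0 (fun a => a ^+ 2) (av_id m_gt0 _ g)).
  by rewrite avD avZ av_mul_lap; apply: functional_extensionality => y; rewrite mulr0 add0r.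
by rewrite avD; congr (_ + _); exact: (congr1 (fun F => F x) (avC _ _ _)).
Qed.

(** The energy of the noisy function is al + X + rho^2 sg. The cross term X averages to zero over
    [i], also against powers of [al], which do not depend on [i]; Cauchy-Schwarz gives X^2 <= 4 al
    (rho^2 sg), as the expansion requires. *)
Lemma noise_step p C rho i A g x :
  (forall a X Y : R, 0 <= a -> 0 <= Y -> X ^+ 2 <= 4 * a * Y ->
    (a + X + Y) ^+ p.+1 <=
    a ^+ p.+1 + p.+1%:R * a ^+ p * X + C%:R * (a ^+ p * Y + Y ^+ p.+1)) ->
  forall al sg : cube -> R, al = av A (fun y => av [set i] g y ^+ 2) ->
  sg = av A (fun y => lap i g y ^+ 2) ->
  av [set i] (fun y => av A (fun z => noise1 rho i g z ^+ 2) y ^+ p.+1) x <=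
  al x ^+ p.+1 + C%:R * (al x ^+ p * (rho ^+ 2 * av [set i] sg x) +
     rho ^+ 2 ^+ p.+1 * av [set i] (fun y => sg y ^+ p.+1) x).
Proof.
move=> HC al sg alE sgE.
pose X y := 2 * rho * av A (fun z => av [set i] g z * lap i g z) y.
have al_i : av [set i] al = al.
  rewrite alE avC; congr (av A _).
  exact: (av_comp m_gt0 (fun a => a ^+ 2) (av_id m_gt0 _ g)).
have X_i : av [set i] X = fun=> 0.
  by rewrite /X avZ avC av_mul_lap av_cst; apply: functional_extensionality => y; rewrite mulr0.
have E y : av A (fun z => noise1 rho i g z ^+ 2) y = al y + X y + rho ^+ 2 * sg y.
  have -> : (fun z => noise1 rho i g z ^+ 2) = (fun z => av [set i] g z ^+ 2 +
     (2 * rho * (av [set i] g z * lap i g z) + rho ^+ 2 * lap i g z ^+ 2)).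
    by apply: functional_extensionality => z; rewrite lap_split; ring.
  by rewrite !avD !avZ addrA alE sgE.
have al0 y : 0 <= al y by rewrite alE; apply: av_ge0 => // z; exact: sqr_ge0.
have sg0 y : 0 <= sg y by rewrite sgE; apply: av_ge0 => // z; exact: sqr_ge0.
apply: le_trans (av_le (g := fun y => al y ^+ p.+1 + (p.+1%:R * (al y ^+ p * X y) +
   C%:R * (rho ^+ 2 * (al y ^+ p * sg y) + rho ^+ 2 ^+ p.+1 * sg y ^+ p.+1))) _ _ _) _.
  move=> y; rewrite E.
  have Y0 : 0 <= rho ^+ 2 * sg y by rewrite mulr_ge0 ?sqr_ge0.
  have X2 : X y ^+ 2 <= 4 * al y * (rho ^+ 2 * sg y).
    have := av_CS m_gt0 A (av [set i] g) (lap i g) y.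
    have := sqr_ge0 rho; rewrite -alE -sgE => r0 /(ler_wpM2l r0) H.
    rewrite /X [leRHS](_ : _ = 4 * (rho ^+ 2 * (al y * sg y))); last by ring.
    apply: le_trans (ler_wpM2l (ler0n R 4) H).
    by rewrite le_eqVlt; apply/orP; left; apply/eqP; ring.
  apply: le_trans (HC _ _ _ (al0 y) Y0 X2) _.
  rewrite [(rho ^+ 2 * sg y) ^+ _]exprMn.
  by rewrite le_eqVlt; apply/orP; left; apply/eqP; ring.
have alp k : av [set i] (fun y => al y ^+ k) = fun y => al y ^+ k.
  exact: (av_comp m_gt0 (fun a => a ^+ k) al_i).
rewrite !avD !avZ avD !avZ alp.
rewrite (av_indep _ (alp p)) X_i (av_indep _ (alp p)).
by rewrite mulr0 mulr0 add0r le_eqVlt; apply/orP; left; apply/eqP; ring.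
Qed.

Lemma av_nil f : av [set j in [::]] f = f.
Proof.
by rewrite (_ : [set j in [::]] = set0) ?av0 //; apply/setP => j; rewrite !inE.
Qed.

Lemma av_cons i s f : av [set j in i :: s] f = av [set j in s] (av [set i] f).
Proof. by rewrite av_av // set_cons setUC. Qed.

(** * Plain and global hypercontractivity, one coordinate at a time *)

Section Moments.
Variables (p C : nat).
Hypothesis C_gt0 : (0 < C)%N.
Hypothesis expansion : forall a X Y : R, 0 <= a -> 0 <= Y -> X ^+ 2 <= 4 * a * Y ->
  (a + X + Y) ^+ p.+2 <=
  a ^+ p.+2 + p.+2%:R * a ^+ p.+1 * X + C%:R * (a ^+ p.+1 * Y + Y ^+ p.+2).

(** As [sg] is at most [m] times its average b over [i], the error terms are at most C rho^2
    al^(p+1) b and C rho^2 (rho^2 m)^(p+1) b^(p+2), which fit inside (al + b)^(p+2). *)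
Lemma noise_step_contract rho i A g x : C%:R * m%:R * rho ^+ 2 <= 1 ->
  av [set i] (fun y => av A (fun z => noise1 rho i g z ^+ 2) y ^+ p.+2) x <=
  av [set i] (av A (fun z => g z ^+ 2)) x ^+ p.+2.
Proof.
move=> Cr; apply: le_trans (@noise_step _ _ rho i A g x expansion _ _ erefl erefl) _.
rewrite (energy_split A i g).
set al := av A _ x; set sg := av A _; set b := av [set i] sg x.
have al0 : 0 <= al by apply: av_ge0 => // z; exact: sqr_ge0.
have sg0 y : 0 <= sg y by apply: av_ge0 => // z; exact: sqr_ge0.
have b0 : 0 <= b by exact: av_ge0.
have r0 := sqr_ge0 rho.
have C1 : 1 <= C%:R :> R by rewrite ler1n.
have m1 : 1 <= m%:R :> R by rewrite ler1n.
apply: le_trans (power_add_ge p al0 b0); rewrite -addrA lerD2l mulrDr.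
have Cr1 : C%:R * rho ^+ 2 <= 1.
  apply: le_trans Cr; rewrite ler_wpM2r // ler_peMr // ler0n.
apply: lerD.
  rewrite [leLHS](_ : _ = (C%:R * rho ^+ 2) * (al ^+ p.+1 * b)); last by ring.
  by rewrite ler_piMl // mulr_ge0 // exprn_ge0.
have T : av [set i] (fun y => sg y ^+ p.+2) x <= (m%:R * b) ^+ p.+1 * b.
  pose F := (fun y => (m%:R * av [set i] sg y) ^+ p.+1).
  have FE : av [set i] F = F.
    exact: (av_comp m_gt0 (fun a => (m%:R * a) ^+ p.+1) (av_id m_gt0 _ sg)).
  have -> : (m%:R * b) ^+ p.+1 * b = av [set i] (fun y => F y * sg y) x.
    by rewrite (av_indep _ FE).
  apply: av_le => // y; rewrite exprSr ler_wpM2r // lerXn2r ?nnegrE ?sg0 //.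
    by rewrite mulr_ge0 ?ler0n // av_ge0.
  exact: le_card_av1.
rewrite mulrA; apply: le_trans (ler_wpM2l _ T) _.
  by rewrite mulr_ge0 ?ler0n // exprn_ge0.
rewrite [leLHS](_ : _ = (C%:R * rho ^+ 2) * (rho ^+ 2 * m%:R) ^+ p.+1 * b ^+ p.+2).
  rewrite ler_piMl ?exprn_ge0 //.
  have X0 : 0 <= rho ^+ 2 * m%:R by rewrite mulr_ge0 ?ler0n.
  have X1 : rho ^+ 2 * m%:R <= 1.
    by apply: le_trans Cr; rewrite mulrC ler_wpM2r // ler_peMl // ler0n.
  exact: (mulr_ile1 (mulr_ge0 (ler0n _ C) r0) (exprn_ge0 _ X0) Cr1 (exprn_ile1 _ X0 X1)).
by rewrite !exprMn !(exprS _ p.+1); ring.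
Qed.

(** With [A] empty this bounds the moment of order 2(p+2) by the second moment. [A] collects the
    coordinates already moved inside the power, so that the induction needs no Minkowski
    inequality. *)
Lemma noise_contract rho s A g x : C%:R * m%:R * rho ^+ 2 <= 1 ->
  av [set j in s] (fun y => av A (fun z => noise rho s g z ^+ 2) y ^+ p.+2) x <=
  av [set j in s] (av A (fun z => g z ^+ 2)) x ^+ p.+2.
Proof.
move=> Cr; elim: s A x => [|i s IH] A x.
  by rewrite !av_nil.
rewrite !av_cons (av_av m_gt0 [set i] A (fun z => g z ^+ 2)).
apply: le_trans (IH _ _); rewrite -av_av //; apply: av_le => // y.
exact: noise_step_contract.
Qed.

(** A sum of [F] over all subsets t of the list: coordinates in t receive a Laplacian, the others
    join [A]. *)
Fixpoint leaves (F : {set I} -> (cube -> R) -> R) s A g : R :=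
  if s is i :: s' then leaves F s' (i |: A) g + leaves F s' A (lap i g) else F A g.

Fixpoint all_leaves (P : {set I} -> (cube -> R) -> Prop) s A g : Prop :=
  if s is i :: s' then all_leaves P s' (i |: A) g /\ all_leaves P s' A (lap i g)
  else P A g.

Lemma leaves_le (F G : {set I} -> (cube -> R) -> R) P c s A g :
  (forall B h, P B h -> F B h <= c * G B h) -> all_leaves P s A g ->
  leaves F s A g <= c * leaves G s A g.
Proof.
move=> FG; elim: s A g => [|i s IH] A g /=; first exact: FG.
by case=> H1 H2; rewrite mulrDr lerD ?IH.
Qed.

(** The term in sg^(p+2), which costs powers of [m] in the contraction, is here kept as the
    Laplacian branch, so the condition on [rho] does not involve [m]. *)
Lemma noise_leaves rho s A g : C%:R * rho ^+ 2 <= 1 ->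
  mean (fun y => av A (fun z => noise rho s g z ^+ 2) y ^+ p.+2) <=
  leaves (fun B h => mean (fun y => av B (fun z => h z ^+ 2) y ^+ p.+2)) s A g.
Proof.
move=> Cr; elim: s A g => [|i s IH] A g //=.
apply: le_trans (lerD (IH _ _) (IH _ _)).
set w := noise rho s g; rewrite noise_lap -/w.
rewrite -(mean_av m_gt0 [set i] (fun y => av A (fun z => noise1 rho i w z ^+ 2) y ^+ p.+2)).
rewrite -(mean_av m_gt0 [set i] (fun y => av A (fun z => lap i w z ^+ 2) y ^+ p.+2)) -meanD.
apply: mean_le => x.
apply: le_trans (@noise_step _ _ rho i A w x expansion _ _ erefl erefl) _.
rewrite -av_av // (energy_split A i w).
set al := av A _ x; set sg := av A _; set b := av [set i] sg x.
have al0 : 0 <= al by apply: av_ge0 => // z; exact: sqr_ge0.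
have sg0 y : 0 <= sg y by apply: av_ge0 => // z; exact: sqr_ge0.
have b0 : 0 <= b by exact: av_ge0.
have r0 := sqr_ge0 rho.
have C1 : 1 <= C%:R :> R by rewrite ler1n.
have t0 : 0 <= av [set i] (fun y => sg y ^+ p.+2) x.
  by apply: av_ge0 => // y; rewrite exprn_ge0.
rewrite mulrDr addrA; apply: lerD.
  apply: (@le_trans _ _ (al ^+ p.+2 + al ^+ p.+1 * b)); last first.
    by apply: le_trans (power_add_ge p al0 b0); rewrite lerDl exprn_ge0.
  rewrite lerD2l [leLHS](_ : _ = (C%:R * rho ^+ 2) * (al ^+ p.+1 * b)); last by ring.
  by rewrite ler_piMl // mulr_ge0 // exprn_ge0.
have r1 : rho ^+ 2 <= 1 by apply: le_trans Cr; rewrite ler_peMl.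
rewrite mulrA ler_piMl // exprS mulrA.
exact: (mulr_ile1 (mulr_ge0 (ler0n _ C) r0) (exprn_ge0 _ r0) Cr (exprn_ile1 _ r0 r1)).
Qed.

End Moments.

Lemma av_set1_noise1 rho i h : av [set i] (noise1 rho i h) = av [set i] h.
Proof.
rewrite avLin (av_id m_gt0); apply: functional_extensionality => x; ring.
Qed.

Lemma mean_energy i g :
  mean (fun y => g y ^+ 2) =
  mean (fun y => av [set i] g y ^+ 2) + mean (fun y => lap i g y ^+ 2).
Proof.
rewrite -(mean_av m_gt0 [set i]) -[X in _ = _ + X](mean_av m_gt0 [set i]) -meanD.
congr mean; apply: functional_extensionality => x.
by have := energy_split set0 i g x; rewrite !av0.
Qed.

(** The Laplacian part in each coordinate is counted in both branches, each time with weight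
    sigma^2; hence the bound 1/2. *)
Lemma leaves_energy sigma s A h : sigma ^+ 2 <= 2^-1 ->
  leaves (fun _ g => mean (fun y => g y ^+ 2)) s A (noise sigma s h)
  <= mean (fun y => h y ^+ 2).
Proof.
move=> s2; elim: s A h => [|i s IH] A h //=.
rewrite noise1_noise -noise_lap lap_noise1.
apply: le_trans (lerD (IH _ _) (IH _ _)) _.
rewrite (mean_energy i) av_set1_noise1 lap_noise1 [leRHS](mean_energy i) -addrA lerD2l.
have -> : (fun y => (sigma * lap i h y) ^+ 2) = (fun y => sigma ^+ 2 * lap i h y ^+ 2).
  by apply: functional_extensionality => y; rewrite exprMn.
rewrite meanZ; have : 0 <= mean (fun y => lap i h y ^+ 2).
  by apply: mean_ge0 => // y; exact: sqr_ge0.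
move: (mean _) => e e0; have := ler_wpM2r e0 s2; lra.
Qed.

End Noise.

#[global] Arguments lap {R I m} i f x.

(** * Noise stability of spread functions *)

Section Stability.
Variables (R : realFieldType) (I : finType) (m : nat).
Hypothesis m_gt0 : (0 < m)%N.
Local Notation cube := {ffun I -> 'I_m}.
Implicit Types (A B Q : {set I}) (x y z : cube) (f g h : cube -> R) (i j : I)
  (s t a : seq I) (rho sigma : R).

(** The tangent inequality for [g ^+ p.+1] at [c = e / nu], averaged against the weight [h]; the
    slack between the mean of [h] and [nu] has the right sign. *)
Lemma av_holder p A h g nu x : (forall y, 0 <= h y) -> (forall y, 0 <= g y) ->
  0 < nu -> av A h x <= nu ->
  av A (fun y => h y * g y) x ^+ p.+1 <= nu ^+ p * av A (fun y => h y * g y ^+ p.+1) x.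
Proof.
move=> h0 g0 nu0 hnu; set e := av A (fun y => h y * g y) x.
have e0 : 0 <= e by apply: av_ge0 => // y; rewrite mulr_ge0.
pose c := e / nu; have c0 : 0 <= c by rewrite divr_ge0 // ltW.
have ecnu : e = c * nu by rewrite /c divfK // gt_eqF.
have H : c ^+ p.+1 * av A h x + p.+1%:R * c ^+ p * (e - c * av A h x)
     <= av A (fun y => h y * g y ^+ p.+1) x.
  rewrite [leLHS](_ : _ = av A (fun y => c ^+ p.+1 * h y +
     p.+1%:R * c ^+ p * (h y * g y - c * h y)) x); last by rewrite avD !avZ avB avZ.
  apply: av_le => y; apply: le_trans (ler_wpM2l (h0 y) (power_tangent p (g0 y) c0)).
  by rewrite le_eqVlt; apply/orP; left; apply/eqP; ring.
have cp : 0 <= c ^+ p by rewrite exprn_ge0.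
apply: le_trans (ler_wpM2l (exprn_ge0 p (ltW nu0)) H).
rewrite ecnu exprMn [leRHS](_ : _ = nu ^+ p * c ^+ p.+1 *
   (nu + p%:R * (nu - av A h x))); last by rewrite -(natr1 p) (exprS c); ring.
rewrite [leLHS](_ : _ = nu ^+ p * c ^+ p.+1 * nu); last by rewrite (exprS nu); ring.
apply: ler_wpM2l; first by rewrite mulr_ge0 ?exprn_ge0 // ltW.
by rewrite lerDl mulr_ge0 ?ler0n // subr_ge0.
Qed.

Section Moments.
Variables (p C : nat).
Hypothesis C_gt0 : (0 < C)%N.
Hypothesis expansion : forall a X Y : R, 0 <= a -> 0 <= Y -> X ^+ 2 <= 4 * a * Y ->
  (a + X + Y) ^+ p.+2 <=
  a ^+ p.+2 + p.+2%:R * a ^+ p.+1 * X + C%:R * (a ^+ p.+1 * Y + Y ^+ p.+2).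

(* Duality: [noise] is self-adjoint, so the second moment of [noise h] is the
   pairing of [h] with its double noise, which Holder's inequality and the
   moment bound [noise_contract] control by the second moment itself. *)
Lemma noise_energy_le rho s h nu x : 0 <= rho <= 1 -> C%:R * m%:R * rho ^+ 2 <= 1 ->
  (forall y, 0 <= h y <= 1) -> 0 < nu -> av [set j in s] h x <= nu ->
  av [set j in s] (fun y => noise rho s h y ^+ 2) x ^+ p.+2 <= nu ^+ (2 * p.+2).-1.
Proof.
move=> r01 Cr h01 nu0 hnu; set S := av _ _ x.
have S0 : 0 <= S by apply: av_ge0 => // y; exact: sqr_ge0.
have h0 y : 0 <= h y by case/andP: (h01 y).
set g := noise rho s (noise rho s h).
have g0 y : 0 <= g y by apply: noise_ge0 => // z; exact: noise_ge0.
have SE : S = av [set j in s] (fun y => h y * g y) x.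
  rewrite /S; under [X in av _ X]functional_extensionality => y do rewrite expr2.
  by rewrite noise_sym // => j js; rewrite inE.
have := av_holder (2 * p.+2).-1 h0 g0 nu0 hnu; rewrite -SE.
have -> : (2 * p.+2).-1.+1 = (2 * p.+2)%N by [].
move=> H.
have H2 : S ^+ (2 * p.+2) <= nu ^+ (2 * p.+2).-1 * S ^+ p.+2.
  apply: le_trans H _; apply: ler_wpM2l; first by rewrite exprn_ge0 // ltW.
  apply: le_trans (av_le (g := fun y => g y ^+ (2 * p.+2)) _ _ _) _.
    move=> y; rewrite ler_piMl ?exprn_ge0 //; by case/andP: (h01 y).
  have := noise_contract m_gt0 C_gt0 expansion s set0 (noise rho s h) x Cr.
  rewrite !av0 // => H'; apply: le_trans H'.
  by under [X in av _ X]functional_extensionality => y do rewrite exprM.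
have [->|Sn0] := eqVneq S 0; first by rewrite expr0n /= exprn_ge0 // ltW.
move: H2; rewrite mul2n -addnn exprD ler_pM2r // exprn_gt0 //.
by rewrite lt0r Sn0.
Qed.

Lemma noise_perm rho s t f : perm_eq s t -> noise rho s f = noise rho t f.
Proof.
elim: s t => [|i s IH] t st; first by move: st; rewrite perm_sym => /perm_nilP ->.
have it : i \in t by rewrite -(perm_mem st) mem_head.
have -> : noise rho t f = noise1 rho i (noise rho (rem i t) f).
  elim: t it {st} => //= j t IHt; rewrite inE eq_sym; case: eqP => [-> //|_] /= it.
  by rewrite IHt // noise1C.
rewrite /= (IH (rem i t)) //.
by rewrite -(perm_cons i) (perm_trans st) // perm_to_rem.
Qed.

Lemma laps_noise1 sigma i t f :
  foldr lap (noise1 sigma i f) t = noise1 sigma i (foldr lap f t).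
Proof. by elim: t => //= j t ->; rewrite noise1_lap. Qed.

Lemma laps_noise sigma t f :
  foldr lap (noise sigma t f) t = fun x => sigma ^+ size t * foldr lap f t x.
Proof.
elim: t f => [|i t IH] f /=; first by apply: functional_extensionality => x; rewrite mul1r.
rewrite noise1_noise // IH laps_noise1; apply: functional_extensionality => x.
have := congr1 (fun F => F x) (lap_noise1 m_gt0 sigma i (foldr lap f t)).
rewrite /lap /= avZ => E; rewrite -mulrBr E exprSr; ring.
Qed.

(** The product over [t] of identity plus average: a nonnegative majorant of the iterated Laplacian,
    to which the bounds for functions with values in [0,1] apply after scaling. *)
Definition envelope t f : cube -> R :=
  foldr (fun i g x => g x + av [set i] g x) f t.

Lemma envelope_bounds t f x : (forall y, 0 <= f y <= 1) ->
  0 <= envelope t f x <= 2 ^+ size t.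
Proof.
move=> f01; elim: t x => [|i t IH] x; first by rewrite expr0 f01.
have e0 y : 0 <= envelope t f y by case/andP: (IH y).
rewrite /= addr_ge0 ?av_ge0 //= exprS mulr_natl mulr2n lerD //.
  by case/andP: (IH x).
have := av_cst m_gt0 [set i] (2 ^+ size t : R) => /(congr1 (fun F => F x)) <-.
by apply: av_le => y; case/andP: (IH y).
Qed.

Lemma laps_envelope t f x : (forall y, 0 <= f y) -> `|foldr lap f t x| <= envelope t f x.
Proof.
move=> f0; elim: t x => [|i t IH] x /=; first by rewrite ger0_norm.
apply: le_trans (ler_normB _ _) _; apply: lerD => //.
by apply: le_trans (av_norm _ _ _) _; apply: av_le.
Qed.

Variables (f : cube -> R) (K mu : R).
Hypothesis K_ge1 : 1 <= K.
Hypothesis mu_gt0 : 0 < mu.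
Hypothesis f01 : forall y, 0 <= f y <= 1.
Hypothesis f_spread : forall Q x, av (~: Q) f x <= K ^+ #|Q| * mu.

(** The product expands into 2^|t| averages of [f]. Averaging over one more coordinate of [Q] leaves
    a smaller set of fixed coordinates, for which spreadness gives a bound no larger, since
    [K >= 1]. *)
Lemma envelope_spread t Q x : uniq t -> {subset t <= Q} ->
  av (~: Q) (envelope t f) x <= 2 ^+ size t * (K ^+ #|Q| * mu).
Proof.
elim: t Q => [|i t IH] Q /=; first by rewrite mul1r.
case/andP=> it ut tQ; rewrite avD av_av // exprS -mulrA mulr_natl mulr2n.
have tQ' j : j \in t -> j \in Q by move=> jt; apply: tQ; rewrite inE jt orbT.
apply: lerD; first exact: IH.
have -> : ~: Q :|: [set i] = ~: (Q :\ i) by rewrite setDE setCI setCK.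
apply: le_trans (IH (Q :\ i) ut _) _.
  by move=> j jt; rewrite !inE tQ' // andbT; apply: contraNneq it => <-.
rewrite ler_wpM2l ?exprn_ge0 ?ler0n // ler_wpM2r ?(ltW mu_gt0) //.
by rewrite ler_weXn2l // subset_leq_card // subD1set.
Qed.

(** [M] bounds mu^(-1/(p+2)), the loss of plain hypercontractivity at density [mu]. *)
Variable M : R.
Hypothesis M_gt0 : 0 < M.
Hypothesis muM : 1 <= mu * M ^+ p.+2.

(** In norm, the noise on [t] gains sigma^|t|, the majorant costs 2^|t| and spreadness costs K^|t|;
    [2 * sigma * K <= 1] balances them. The noise on [a] supplies the plain bound. *)
Lemma leaf_le sigma t a x : perm_eq (t ++ a) (enum I) ->
  0 <= sigma <= 1 -> C%:R * m%:R * sigma ^+ 2 <= 1 -> 2 * sigma * K <= 1 ->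
  av [set j in a] (fun y => foldr lap (noise sigma (enum I) f) t y ^+ 2) x <= mu ^+ 2 * M.
Proof.
move=> ta s01 Cs sK.
have [s0 s1] := andP s01.
have f0 y : 0 <= f y by case/andP: (f01 y).
have uta : uniq (t ++ a) by rewrite (perm_uniq ta) enum_uniq.
have [ut ata ua] : [/\ uniq t, ~~ has (mem t) a & uniq a] by apply/and3P; rewrite -cat_uniq.
have aE : [set j in a] = ~: [set j in t].
  apply/setP=> j; rewrite !inE; have := perm_mem ta j; rewrite mem_cat mem_enum /=.
  have [jt _|_ /= -> //] := boolP (j \in t).
  apply/negP => ja; move/hasPn: ata => /(_ j ja); by rewrite /= jt.
rewrite -(noise_perm sigma f ta) /noise foldr_cat -/(noise sigma a f) -/(noise sigma t _).
rewrite laps_noise.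
set n := size t; pose hh := fun y => 2 ^- n * envelope t f y.
have hh01 y : 0 <= hh y <= 1.
  have /andP[e0 e1] := envelope_bounds t y f01.
  by rewrite /hh mulr_ge0 ?invr_ge0 ?exprn_ge0 //= mulrC ler_pdivrMr ?exprn_gt0 // mul1r.
have cardt : #|[set j in t]| = n by rewrite cardsE; exact/card_uniqP.
have nu0 : 0 < K ^+ n * mu by rewrite mulr_gt0 // exprn_gt0 // (lt_le_trans ltr01).
have hnu : av [set j in a] hh x <= K ^+ n * mu.
  rewrite avZ mulrC ler_pdivrMr ?exprn_gt0 // mulrC aE -cardt.
  by rewrite {1}cardt; apply: envelope_spread => // j jt; rewrite inE.
have := noise_energy_le s01 Cs hh01 nu0 hnu.
set S := av _ _ x => HS.
have S0 : 0 <= S by apply: av_ge0 => // y; exact: sqr_ge0.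
have Kn : 1 <= K ^+ n by rewrite exprn_ege1.
have SM : S <= K ^+ n ^+ 2 * (mu ^+ 2 * M).
  have P0 : 0 <= K ^+ n ^+ 2 * (mu ^+ 2 * M).
    exact: (mulr_ge0 (sqr_ge0 _) (mulr_ge0 (sqr_ge0 _) (ltW M_gt0))).
  rewrite -(@ler_pXn2r _ p.+2) ?nnegrE //; apply: le_trans HS _.
  have nup : 0 < (K ^+ n * mu) ^+ (2 * p.+2).-1 by rewrite exprn_gt0.
  have KmuM : 1 <= K ^+ n * mu * M ^+ p.+2.
    rewrite -mulrA; apply: le_trans muM _; rewrite ler_peMl // mulr_ge0 ?exprn_ge0 // ltW //.
  apply: le_trans (_ : (K ^+ n * mu) ^+ (2 * p.+2).-1 * (K ^+ n * mu * M ^+ p.+2) <= _).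
    by rewrite ler_peMr // ltW.
  rewrite mulrA -exprSr (_ : (2 * p.+2).-1.+1 = 2 * p.+2)%N // exprM -exprMn.
  by rewrite le_eqVlt; apply/orP; left; apply/eqP; congr (_ ^+ _); ring.
apply: le_trans (_ : (2 ^+ n * sigma ^+ n) ^+ 2 * S <= _); last first.
  apply: le_trans (ler_wpM2l (sqr_ge0 _) SM) _.
  rewrite (mulrA ((2 ^+ n * sigma ^+ n) ^+ 2)) -!exprMn.
  apply: ler_piMl; first exact: (mulr_ge0 (sqr_ge0 _) (ltW M_gt0)).
  have sK0 : 0 <= 2 * sigma * K by rewrite !mulr_ge0 // (le_trans ler01).
  exact: exprn_ile1 (exprn_ge0 _ sK0) (exprn_ile1 _ sK0 sK).
have := avZ [set j in a] ((2 ^+ n * sigma ^+ n) ^+ 2) (fun y => noise sigma a hh y ^+ 2).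
move=> /(congr1 (fun F => F x)) <-; apply: av_le => y.
rewrite -exprMn -[leLHS]real_normK ?num_real // ler_pXn2r ?nnegrE //; last first.
  by rewrite !mulr_ge0 ?exprn_ge0 // noise_ge0 // => z; case/andP: (hh01 z).
rewrite normrM (ger0_norm (exprn_ge0 _ s0)) (mulrC (2 ^+ n)) -mulrA.
rewrite ler_wpM2l ?exprn_ge0 //.
have -> : foldr lap (noise sigma a f) t = noise sigma a (foldr lap f t).
  by elim: (t) => //= i t' ->; rewrite noise_lap.
apply: le_trans (noise_norm a _ y s01) _.
have := noiseZ sigma a (2 ^+ n) hh => /(congr1 (fun F => F y)) <-.
apply: noise_le => // z; apply: le_trans (laps_envelope t z f0) _.
by rewrite /hh mulrA divff ?mul1r // expf_neq0 // pnatr_eq0.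
Qed.

Lemma all_leaves_le sigma s t a : perm_eq (s ++ t ++ a) (enum I) ->
  0 <= sigma <= 1 -> C%:R * m%:R * sigma ^+ 2 <= 1 -> 2 * sigma * K <= 1 ->
  all_leaves (fun A h => forall x, av A (fun y => h y ^+ 2) x <= mu ^+ 2 * M)
    s [set j in a] (foldr lap (noise sigma (enum I) f) t).
Proof.
move=> + s01 Cs sK; elim: s t a => [|i s IH] t a sta /=; first by move=> x; exact: leaf_le.
split; [rewrite -set_cons; apply: (IH t (i :: a))|apply: (IH (i :: t) a)];
  apply: (perm_trans (_ : perm_eq _ ((i :: s) ++ t ++ a)) sta);
  by apply/seq.permP => P; rewrite /= !count_cat /= ?count_cat; lia.
Qed.

(** At each leaf all but one of the p + 2 factors are bounded uniformly by [V], thanks to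
    spreadness; the remaining factors sum to at most one energy. Holder passes from this moment
    bound to the pairing with [f]. *)
Lemma noise_stability rho sigma : 0 <= rho <= 1 -> 0 <= sigma <= 1 -> mean f <= mu ->
  C%:R * rho ^+ 2 <= 1 -> C%:R * m%:R * sigma ^+ 2 <= 1 -> sigma * K <= 1 ->
  mean (fun y => f y * noise (rho * (2^-1 * sigma)) (enum I) f y) <= mu ^+ 2 * M.
Proof.
move=> r01 s01 fmu Cr Cs sK.
have [s0 s1] := andP s01; have [r0 r1] := andP r01.
have f0 y : 0 <= f y by case/andP: (f01 y).
set V := mu ^+ 2 * M; have V0 : 0 <= V by rewrite mulr_ge0 ?sqr_ge0 // ltW.
(* Halving serves twice: it meets the factor 2 of the leaf bound, and noise at sigma / 2 is noise at
   1/2 after noise at sigma, where 1/2 makes the leaf energies sum. *)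
pose s' := 2^-1 * sigma.
have s01' : 0 <= s' <= 1 by rewrite /s'; apply/andP; split; lra.
have Cs' : C%:R * m%:R * s' ^+ 2 <= 1.
  apply: le_trans Cs; rewrite ler_wpM2l ?mulr_ge0 ?ler0n //.
  by rewrite lerXn2r ?nnegrE // /s'; lra.
have sK' : 2 * s' * K <= 1 by rewrite /s' mulrA divff ?mul1r // pnatr_eq0.
have K0 : 0 <= K by rewrite (le_trans ler01).
have Vs : mean (fun y => noise sigma (enum I) f y ^+ 2) <= V.
  pose x0 : cube := [ffun=> Ordinal m_gt0].
  have eT : [set j in enum I] = setT by apply/setP=> j; rewrite !inE mem_enum.
  have := noise_energy_le (s := enum I) (x := x0) s01 Cs f01 mu_gt0.
  rewrite eT -!meanE => /(_ fmu) H.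
  rewrite -(@ler_pXn2r _ p.+2) ?nnegrE ?mean_ge0 // => [|y]; last exact: sqr_ge0.
  apply: le_trans H _; rewrite exprMn -exprM (_ : 2 * p.+2 = (2 * p.+2).-1.+1)%N // exprSr -mulrA.
  by rewrite ler_peMr ?exprn_ge0 // ltW.
set g := noise rho (enum I) (noise s' (enum I) f).
have g0 y : 0 <= g y by apply: noise_ge0 => // z; exact: noise_ge0.
have gM : mean (fun y => g y ^+ (2 * p.+2)) <= V ^+ p.+2.
  under [X in mean X]functional_extensionality => y do rewrite exprM.
  have H := noise_leaves m_gt0 C_gt0 expansion (enum I) set0 (noise s' (enum I) f) Cr.
  rewrite av0 // in H; apply: le_trans H _.
  have AL := all_leaves_le (s := enum I) (t := [::]) (a := [::]) _ s01' Cs' sK'.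
  rewrite !cats0 (_ : [set j in [::]] = set0) in AL; last by apply/setP=> j; rewrite !inE.
  have LE := @leaves_le R I m (fun B h => mean (fun y => av B (fun z => h z ^+ 2) y ^+ p.+2))
    (fun _ h => mean (fun y => h y ^+ 2)) _ (V ^+ p.+1) (enum I) set0 _ _ (AL (perm_refl _)).
  apply: le_trans (LE _) _ => [B h hV|].
    rewrite -(mean_av m_gt0 B (fun y => h y ^+ 2)) -meanZ; apply: mean_le => y.
    have h0 : 0 <= av B (fun z => h z ^+ 2) y by apply: av_ge0 => // z; exact: sqr_ge0.
    by rewrite exprSr ler_wpM2r // lerXn2r ?nnegrE.
  rewrite [leRHS]exprSr ler_wpM2l ?exprn_ge0 // -(noise_noise m_gt0).
  apply: le_trans (leaves_energy m_gt0 _ _ _ _) Vs.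
  by rewrite -subr_ge0 expr2; lra.
set E := mean _; have EE : E = mean (fun y => f y * g y).
  by rewrite /E /g (noise_noise m_gt0).
have E0 : 0 <= E by rewrite EE mean_ge0 // => y; rewrite mulr_ge0.
rewrite -(@ler_pXn2r _ (2 * p.+2)) ?nnegrE //.
pose x0 : cube := [ffun=> Ordinal m_gt0].
have fx : av setT f x0 <= mu by rewrite -meanE.
have := av_holder (2 * p.+2).-1 f0 g0 mu_gt0 fx; rewrite -!meanE -EE.
rewrite (_ : (2 * p.+2).-1.+1 = 2 * p.+2)%N // => H; apply: le_trans H _.
have P0 : 0 <= mu ^+ (2 * p.+2).-1 by rewrite exprn_ge0 // ltW.
apply: (@le_trans _ _ (mu ^+ (2 * p.+2).-1 * V ^+ p.+2)).
  rewrite ler_wpM2l //; apply: le_trans gM; apply: mean_le => y.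
  by rewrite ler_piMl ?exprn_ge0 //; case/andP: (f01 y).
rewrite mulnC exprM (expr2 (V ^+ p.+2)) ler_wpM2r ?exprn_ge0 //.
rewrite /V exprMn -exprM (_ : 2 * p.+2 = (2 * p.+2).-1.+1)%N // exprSr -mulrA mulnC.
by rewrite ler_peMr.
Qed.

(** An orthogonal component on r coordinates receives weight theta^r, at most theta unless r = 0. In
    the induction the Laplacian part already carries one factor theta, so for it the trivial bound
    [bound] suffices. *)
Lemma mean_pairing_le theta s g : 0 <= theta <= 1 ->
  mean (fun y => g y * noise theta s g y) <=
  (1 - theta) * mean (fun y => av [set j in s] g y ^+ 2) + theta * mean (fun y => g y ^+ 2).
Proof.
case/andP=> t0 t1; elim: s g => [|i s IH] g.
  rewrite av_nil // -mulrDl subrK mul1r; apply: mean_le => y; by rewrite expr2.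
set a := av [set i] g; set b := lap i g.
have bound h : mean (fun y => h y * noise theta s h y) <= mean (fun y => h y ^+ 2).
  apply: le_trans (IH h) _.
  have X : mean (fun y => av [set j in s] h y ^+ 2) <= mean (fun y => h y ^+ 2).
    rewrite -[leRHS](mean_av m_gt0 [set j in s]).
    by apply: mean_le => y; exact: av_sqr_le.
  have t1' : 0 <= 1 - theta by rewrite subr_ge0.
  by have := ler_wpM2l t1' X; lra.
have -> : mean (fun y => g y * noise theta (i :: s) g y) =
   mean (fun y => a y * noise theta s a y) + theta * mean (fun y => b y * noise theta s b y).
  set w := noise theta s g.
  have aw : noise theta s a = av [set i] w by rewrite -av_noise.
  have bw : noise theta s b = lap i w by rewrite noise_lap.
  have Z (u v : cube -> R) : mean (fun y => av [set i] u y * lap i v y) = 0.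
    by rewrite -(mean_av m_gt0 [set i]) av_mul_lap // mean_cst.
  rewrite /= -/w lap_split aw bw -meanZ -meanD -[RHS]addr0 -(Z g (fun y => theta * w y)).
  rewrite -[RHS]addr0 -(Z w g) -!meanD; congr mean.
  apply: functional_extensionality => y; rewrite /a /b /lap avZ; ring.
apply: le_trans (lerD (IH a) (ler_wpM2l t0 (bound b))) _.
rewrite av_cons // -/a -addrA lerD2l -mulrDr.
by rewrite (mean_energy m_gt0 i g).
Qed.

End Moments.
End Stability.

(** * Stability at rate 1/m by convexity *)

Section SmallNoise.
Variables (R : realFieldType) (I : finType) (m : nat).
Hypothesis m_gt0 : (0 < m)%N.
Local Notation cube := {ffun I -> 'I_m}.
Implicit Types (f g : cube -> R).

Lemma set_of_enum : [set j in enum I] = setT.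
Proof. by apply/setP=> j; rewrite !inE mem_enum. Qed.

Lemma mean_noise rho s f : mean (noise rho s f) = mean f.
Proof.
pose x : cube := [ffun=> Ordinal m_gt0].
by rewrite (meanE _ x) av_noise // avT noise_cst.
Qed.

Lemma mean_noise_sym rho s f g :
  mean (fun x => noise rho s f x * g x) = mean (fun x => f x * noise rho s g x).
Proof.
pose x : cube := [ffun=> Ordinal m_gt0].
by rewrite !(meanE _ x) noise_sym // => j; rewrite inE.
Qed.

Lemma small_noise_stability p C f (K : R) (w : nat) (lam : R) : (0 < C)%N ->
  (forall a X Y : R, 0 <= a -> 0 <= Y -> X ^+ 2 <= 4 * a * Y ->
    (a + X + Y) ^+ p.+2 <=
    a ^+ p.+2 + p.+2%:R * a ^+ p.+1 * X + C%:R * (a ^+ p.+1 * Y + Y ^+ p.+2)) ->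
  (forall y, 0 <= f y <= 1) -> 1 <= K -> K <= w%:R -> (m <= 16 * w ^ 4)%N ->
  0 < mean f -> (forall (Q : {set I}) x, av (~: Q) f x <= K ^+ #|Q| * mean f) ->
  1 <= mean f * (2 * w%:R) ^+ p.+2 ->
  0 <= lam -> lam * (16 * C%:R ^+ 2 * w%:R ^+ 2) <= 1 ->
  mean (fun x => f x * noise lam (enum I) f x) <=
    mean f ^+ 2 * (1 + 32 * C%:R ^+ 2 * w%:R ^+ 3 * lam).
Proof.
move=> C0 expansion f01 K1 Kw mw mu0 spread muw lam0 lam1.
set mu := mean f in mu0 muw *.
have w1 : 1 <= w%:R :> R by exact: le_trans Kw.
have w0 : 0 < w%:R :> R by exact: lt_le_trans w1.
have c1 : 1 <= C%:R :> R by rewrite ler1n.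
have c0 : 0 < C%:R :> R by exact: lt_le_trans c1.
have cn : C%:R != 0 :> R by rewrite gt_eqF.
have wn : w%:R != 0 :> R by rewrite gt_eqF.
set c := C%:R in c0 c1 cn lam1 *; set W := w%:R in w0 w1 wn lam1 Kw muw *.
have cW : 1 <= c * W by rewrite -[1]mulr1 ler_pM.
have cWW : 1 <= c * W ^+ 2 by rewrite expr2 mulrA -[1]mulr1 ler_pM.
(* The constants make C^-1 * (sigma / 2) the exact square of [l0], so stability at that rate is the
   energy of the function smoothed at [l0]. As m <= 16 W^4, [sigma] satisfies C m sigma^2 <= 1. *)
pose l0 : R := (4 * c * W)^-1; pose sigma : R := (8 * c * W ^+ 2)^-1.
have s0 : 0 <= sigma by rewrite invr_ge0; nra.
have M0 : 0 < 2 * W by lra.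
have S := noise_stability m_gt0 C0 expansion K1 mu0 f01 spread M0 muw
  (rho := c^-1) (sigma := sigma) _ _ (lexx mu) _ _ _.
have {S} S : mean (fun y => f y * noise (l0 * l0) (enum I) f y) <= mu ^+ 2 * (2 * W).
  have -> : l0 * l0 = c^-1 * (2^-1 * sigma) by rewrite /l0 /sigma; field; rewrite cn wn.
  apply: S.
  - by rewrite invr_ge0 (ltW c0) invf_le1.
  - by rewrite s0 invf_le1; nra.
  - by rewrite exprVn ler_pdivrMr ?exprn_gt0 // mul1r expr2 ler_peMr // ltW.
  - rewrite exprVn ler_pdivrMr ?exprn_gt0 ?mul1r //; last by nra.
    have : m%:R <= 16 * W ^+ 4 by rewrite -natrX -natrM ler_nat.
    move=> /(ler_wpM2l (ltW c0)) /le_trans; apply.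
    rewrite [leRHS](_ : _ = 64 * c * (c * W ^+ 4)); last by ring.
    rewrite mulrCA; have : 0 < c * W ^+ 4 by rewrite mulr_gt0 ?exprn_gt0.
    by nra.
  - rewrite mulrC ler_pdivrMr ?mul1r; last by nra.
    by apply: le_trans Kw _; rewrite expr2 in cWW *; nra.
(* theta = lam / l0^2: stability at rate [lam] is the pairing, at rate theta, of the function
   already smoothed at [l0]. *)
set theta := lam * (16 * c ^+ 2 * W ^+ 2) in lam1.
have t0 : 0 <= theta by rewrite mulr_ge0 // !mulr_ge0 ?exprn_ge0 // ltW.
have P := mean_pairing_le m_gt0 (enum I) (noise l0 (enum I) f) (introT andP (conj t0 lam1)).
have lamE : lam = l0 * theta * l0 by rewrite /l0 /theta; field; rewrite cn wn.
rewrite set_of_enum avT // mean_noise -/mu mean_cst // in P.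
have E1 : mean (fun y => noise l0 (enum I) f y * noise theta (enum I) (noise l0 (enum I) f) y)
   = mean (fun x => f x * noise lam (enum I) f x).
  by rewrite mean_noise_sym !noise_noise // -lamE.
have E2 : mean (fun y => noise l0 (enum I) f y ^+ 2) = mean (fun y => f y * noise (l0 * l0) (enum I) f y).
  rewrite -noise_noise // -(mean_noise_sym l0 (enum I) f (noise l0 (enum I) f)); congr mean.
rewrite E1 E2 in P; apply: le_trans P _.
have := ler_wpM2l t0 S.
rewrite [X in _ <= X -> _](_ : _ = mu ^+ 2 * (32 * c ^+ 2 * W ^+ 3 * lam)); last first.
  by rewrite /theta; ring.
have : 0 <= theta * mu ^+ 2 by rewrite mulr_ge0 ?sqr_ge0.
by lra.
Qed.

End SmallNoise.

(** * Random colourings of the alphabets *)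

Section Coloring.
Variables (R : realFieldType) (I : finType) (m : nat).
Hypothesis m_gt0 : (0 < m)%N.
Local Notation cube := {ffun I -> 'I_m}.
Implicit Types (x y z : cube) (f g : cube -> R) (i : I) (s : seq I) (rho : R).

Lemma overwrite_upd i s x y b : i \notin s ->
  overwrite [set j in i :: s] x (upd y i b) = overwrite [set j in s] (upd x i b) y.
Proof.
move=> si; apply/ffunP=> j; rewrite !ffunE !inE.
by case: eqP => [->|_] //=; rewrite (negPf si).
Qed.

Lemma noise_kernel rho s f x : uniq s ->
  noise rho s f x = mean (fun y =>
    (\prod_(i <- s) (1 - rho + rho * m%:R * (x i == y i)%:R)) * f (overwrite [set i in s] x y)).
Proof.
have mR : m%:R != 0 :> R by rewrite pnatr_eq0 -lt0n.
elim: s x => [|i s IH] x /=.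
  move=> _; rewrite -[LHS](mean_cst I m_gt0 (f x)); congr mean.
  apply: functional_extensionality => y; rewrite big_nil mul1r; congr (f _).
  by apply/ffunP=> j; rewrite ffunE inE.
case/andP=> si us; rewrite /noise1 av1E // IH //.
under eq_bigr => a _ do rewrite IH //.
set P := fun x y : cube => \prod_(i <- s) (1 - rho + rho * m%:R * (x i == y i)%:R).
have PU a y z : P (upd y i a) z = P y z.
  rewrite /P [LHS]big_seq [RHS]big_seq; apply: eq_bigr => j js; rewrite ffunE.
  by case: (j =P i) => // ji; move: si; rewrite -ji js.
have PU' a y z : P y (upd z i a) = P y z.
  rewrite /P [LHS]big_seq [RHS]big_seq; apply: eq_bigr => j js; rewrite [upd _ _ _ _]ffunE.
  by case: (j =P i) => // ji; move: si; rewrite -ji js.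
rewrite -[RHS](mean_av m_gt0 [set i]).
rewrite -meanZ -mean_bigsum -meanZ -meanZ -meanD; congr mean.
apply: functional_extensionality => y; rewrite av1E //.
under [in RHS]eq_bigr => b _ do rewrite big_cons overwrite_upd // ffunE eqxx -/(P _ _) PU'.
rewrite -/(P x y); set G := fun b : 'I_m => P x y * f (overwrite [set j in s] (upd x i b) y).
rewrite [in LHS](eq_bigr G) => [|b _]; last by rewrite /G -(PU b).
have -> : P x y * f (overwrite [set j in s] x y) = G (x i).
  rewrite /G; congr (_ * f (overwrite _ _ _)).
  by apply/ffunP=> j; rewrite ffunE; case: eqP => // ->.
have -> : \sum_b (1 - rho + rho * m%:R * (x i == b)%:R) * P x y *
     f (overwrite [set j in s] (upd x i b) y) =
    (1 - rho) * (\sum_b G b) + rho * m%:R * G (x i).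
  rewrite mulr_sumr (bigD1 (x i)) //= [in RHS](bigD1 (x i)) //= eqxx mulr1 [RHS]addrAC /G.
  congr (_ + _); first by ring.
  by apply: eq_bigr => b; rewrite eq_sym => /negPf ->; rewrite mulr0 addr0 mulrA.
by field.
Qed.

Lemma perm_pair_transitive (a b a0 b0 : 'I_m) : a != b -> a0 != b0 ->
  exists2 t : {perm 'I_m}, t a = a0 & t b = b0.
Proof.
move=> ab ab0; pose c := tperm a a0 b.
have ca0 : c != a0 by rewrite /c -[X in _ != X](tpermL a a0) (inj_eq perm_inj) eq_sym.
exists (tperm a a0 * tperm c b0)%g; rewrite permM; last by rewrite tpermL.
by rewrite tpermL tpermD // eq_sym.
Qed.

Section BlockProbabilities.
Variable P : {set 'I_m}.
Local Notation hit a b := (\sum_(t : {perm 'I_m}) ((t a \in P) && (t b \in P))%:R : R).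
Local Notation perms := (#|{: {perm 'I_m}}|%:R : R).

Lemma sum_ord_cst (c : R) : m%:R * c = \sum_(b < m) c.
Proof. by rewrite sumr_const card_ord mulr_natl. Qed.

Lemma hit_perm (t : {perm 'I_m}) a b : hit (t a) (t b) = hit a b.
Proof.
rewrite [RHS](reindex_inj (mulgI t)) /=.
by apply: eq_bigr => u _; rewrite !permM.
Qed.

Lemma sum_perm_mem (t : {perm 'I_m}) : \sum_a (t a \in P)%:R = #|P|%:R :> R.
Proof.
transitivity (\sum_a (a \in P)%:R : R); first by rewrite [RHS](reindex_inj (@perm_inj _ t)).
by rewrite -natr_sum -big_mkcond sum1_card.
Qed.

Lemma hit_diag a : m%:R * hit a a = perms * #|P|%:R.
Proof.
transitivity (\sum_b hit b b).
  rewrite sum_ord_cst; apply: eq_bigr => b _.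
  by rewrite -(hit_perm (tperm a b)) tpermL.
rewrite exchange_big /= mulr_natl -sumr_const; apply: eq_bigr => t _.
by rewrite -[RHS](sum_perm_mem t); apply: eq_bigr => b _; rewrite andbb.
Qed.

Lemma hit_neq a b : a != b ->
  m%:R * (m%:R - 1) * hit a b = perms * (#|P|%:R * (#|P|%:R - 1)).
Proof.
move=> ab.
have E : \sum_a' \sum_b' hit a' b' = perms * #|P|%:R ^+ 2.
  transitivity (\sum_(t : {perm 'I_m}) (#|P|%:R ^+ 2 : R)); last by rewrite sumr_const mulr_natl.
  under eq_bigr => a' _ do rewrite exchange_big /=.
  rewrite exchange_big /=; apply: eq_bigr => t _.
  rewrite -(sum_perm_mem t) expr2 mulr_suml; apply: eq_bigr => a' _.
  rewrite mulr_sumr; apply: eq_bigr => b' _.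
  by case: (_ \in P); case: (_ \in P); rewrite /= ?mulr1 ?mulr0.
have F : \sum_a' \sum_b' hit a' b' = m%:R * (m%:R - 1) * hit a b + m%:R * hit a a.
  rewrite -mulrA -mulrDr sum_ord_cst; apply: eq_bigr => a' _.
  rewrite (bigD1 a') //= addrC; congr (_ + _); last first.
    by rewrite -(hit_perm (tperm a a')) tpermR.
  rewrite (eq_bigr (fun=> hit a b)); last first.
    move=> b'; rewrite eq_sym => ab'.
    by have [t <- <-] := perm_pair_transitive ab ab'; rewrite hit_perm.
  by rewrite sumr_const cardC1 card_ord -[LHS]mulr_natl -subn1 natrB.
rewrite E hit_diag in F.
transitivity (perms * #|P|%:R ^+ 2 - perms * #|P|%:R); last by ring.
by rewrite F addrK.
Qed.

Hypotheses (m_gt1 : (1 < m)%N) (P_gt0 : (0 < #|P|)%N).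
Local Notation density := (#|P|%:R / m%:R : R).
(** The rate at which the probability that two values both land in the block [P] is, up to scaling,
    exactly a noise kernel; of order 1/m when the block is a fixed fraction of the alphabet. *)
Let lam : R := (m%:R / #|P|%:R - 1) / (m%:R - 1).

Lemma hitE a b : hit a b = perms * density ^+ 2 * (1 - lam + lam * m%:R * (a == b)%:R).
Proof.
have m0 : m%:R != 0 :> R by rewrite pnatr_eq0 -lt0n.
have P0 : #|P|%:R != 0 :> R by rewrite pnatr_eq0 -lt0n.
have m1 : m%:R - 1 != 0 :> R by rewrite subr_eq0 pnatr_eq1; case: (m) m_gt1 => [|[]].
case: (altP (a =P b)) => [<-|ab] /=; rewrite ?mulr1 ?mulr0 ?addr0.
  apply: (mulfI m0); rewrite hit_diag /lam; by field; rewrite m0 P0 m1.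
apply: (mulfI (mulf_neq0 m0 m1)); rewrite hit_neq // /lam; by field; rewrite m0 P0 m1.
Qed.

Let coloring := {ffun I -> {perm 'I_m}}.

Definition colored_mass f (w : coloring) : R :=
  \sum_x f x * \prod_i (w i (x i) \in P)%:R.

Let scale : R := density ^+ #|I| * #|{: cube}|%:R.

Lemma card_coloring : #|{: coloring}|%:R = perms ^+ #|I| :> R.
Proof. by rewrite card_ffun natrX. Qed.

Lemma sum_colored_mass f :
  \sum_w colored_mass f w = #|{: coloring}|%:R * (scale * mean f).
Proof.
have m0 : m%:R != 0 :> R by rewrite pnatr_eq0 -lt0n.
rewrite exchange_big /= card_coloring mean_sum /scale.
rewrite [RHS](_ : _ = (perms * density) ^+ #|I| * \sum_x f x); last first.
  set d := density; rewrite (exprMn #|I| (perms : R) d).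
  by field; rewrite card_cube_neq0.
rewrite mulr_sumr; apply: eq_bigr => x _; rewrite -mulr_sumr mulrC; congr (_ * _).
rewrite -(bigA_distr_bigA (fun i (t : {perm 'I_m}) => (t (x i) \in P)%:R : R)) -prodr_const.
apply: eq_bigr => i _; apply: (mulfI m0).
rewrite [RHS](_ : _ = perms * #|P|%:R); last by field.
rewrite -(hit_diag (x i)).
by congr (_ * _); apply: eq_bigr => t _; rewrite andbb.
Qed.

(** Over pairs of strings the coordinates are independent and each contributes one factor of the
    noise kernel, so the second moment is exactly a stability. *)
Lemma sum_colored_mass_sqr f :
  \sum_w colored_mass f w ^+ 2 = #|{: coloring}|%:R *
    (scale ^+ 2 * mean (fun x => f x * noise lam (enum I) f x)).
Proof.
transitivity (\sum_x \sum_y f x * f y * \prod_i hit (x i) (y i)).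
  transitivity (\sum_w \sum_x \sum_y f x * f y *
      \prod_i (((w : coloring) i (x i) \in P) && (w i (y i) \in P))%:R).
    apply: eq_bigr => w _; rewrite expr2 mulr_suml; apply: eq_bigr => x _.
    rewrite mulr_sumr; apply: eq_bigr => y _; rewrite mulrACA -big_split /=.
    by congr (_ * _); apply: eq_bigr => i _; rewrite -natrM mulnb.
  rewrite exchange_big; apply: eq_bigr => x _; rewrite exchange_big; apply: eq_bigr => y _.
  rewrite -mulr_sumr; congr (_ * _).
  by rewrite (bigA_distr_bigA (fun i (t : {perm 'I_m}) => ((t (x i) \in P) && (t (y i) \in P))%:R : R)).
pose ker x y := \prod_i (1 - lam + lam * m%:R * (x i == y i)%:R).
have noiseE x : noise lam (enum I) f x = mean (fun y => ker x y * f y).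
  rewrite noise_kernel ?enum_uniq // set_of_enum; congr mean.
  apply: functional_extensionality => y; rewrite overwriteT /ker.
  by rewrite big_enum.
have -> : \sum_x \sum_y f x * f y * \prod_i hit (x i) (y i) =
    (perms * density ^+ 2) ^+ #|I| * \sum_x \sum_y f x * f y * ker x y.
  rewrite mulr_sumr; apply: eq_bigr => x _; rewrite mulr_sumr; apply: eq_bigr => y _.
  rewrite [RHS]mulrCA; congr (_ * _); rewrite -prodr_const -big_split /=.
  by apply: eq_bigr => i _; rewrite hitE.
rewrite card_coloring mean_sum; under [in RHS]eq_bigr => x _ do rewrite noiseE mean_sum.
have -> : \sum_x f x * (#|{: cube}|%:R^-1 * \sum_y ker x y * f y) =
   #|{: cube}|%:R^-1 * \sum_x \sum_y f x * f y * ker x y.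
  rewrite mulr_sumr; apply: eq_bigr => x _; rewrite mulrCA; congr (_ * _).
  by rewrite mulr_sumr; apply: eq_bigr => y _; rewrite mulrAC mulrA mulrAC.
rewrite /scale; set d := density.
have -> : (perms * d ^+ 2) ^+ #|I| = perms ^+ #|I| * d ^+ #|I| ^+ 2.
  by rewrite exprMn -!exprM mulnC.
by field; rewrite card_cube_neq0.
Qed.

(** Chebyshev: a vanishing mass deviates from the mean [z] by [z] itself. *)
Lemma card_coloring_zero_le f eps : 0 < mean f ->
  mean (fun x => f x * noise lam (enum I) f x) <= mean f ^+ 2 * (1 + eps) ->
  \sum_w (colored_mass f w == 0)%:R <= eps * #|{: coloring}|%:R.
Proof.
move=> mu0 stab; set z := scale * mean f.
have z0 : 0 < z.
  rewrite !mulr_gt0 ?card_cube_gt0 // exprn_gt0 // divr_gt0 ?ltr0n //.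
have z2 : 0 < z ^+ 2 by rewrite exprn_gt0.
rewrite -(ler_pM2r z2).
apply: (@le_trans _ _ (\sum_w (colored_mass f w - z) ^+ 2)).
  rewrite mulr_suml; apply: ler_sum => w _.
  by case: eqP => [->|_]; rewrite ?mul1r ?sub0r ?sqrrN // mul0r sqr_ge0.
have -> : \sum_w (colored_mass f w - z) ^+ 2 = \sum_w colored_mass f w ^+ 2
    - 2 * z * (\sum_w colored_mass f w) + #|{: coloring}|%:R * z ^+ 2.
  rewrite (eq_bigr (fun w => colored_mass f w ^+ 2 - 2 * z * colored_mass f w + z ^+ 2)).
    by rewrite big_split /= sumrB -mulr_sumr sumr_const -[z ^+ 2 *+ _]mulr_natl.
  by move=> w _; ring.
rewrite sum_colored_mass sum_colored_mass_sqr -/z.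
have W0 : 0 <= #|{: coloring}|%:R * scale ^+ 2 by rewrite mulr_ge0 ?sqr_ge0 ?ler0n.
have := ler_wpM2l W0 stab; rewrite -subr_ge0 => H.
rewrite -subr_ge0; move: H; rewrite /z; move: (mean _) (mean _) (scale) => a b c; move: (#|_|%:R) => d H.
by apply: le_trans H _; rewrite le_eqVlt; apply/orP; left; apply/eqP; ring.
Qed.

End BlockProbabilities.

(* Random permutations of each alphabet give every family its own block of
   values, so strings whose values all land in their blocks disagree everywhere. *)
Lemma exists_disagreeing (h b : nat) (f : 'I_h -> cube -> R) (eps : R) :
  (1 < m)%N -> (0 < b)%N -> (h * b <= m)%N -> h%:R * eps < 1 ->
  (forall j, 0 < mean (f j)) ->
  (forall j, mean (fun x => f j x *
      noise ((m%:R / b%:R - 1) / (m%:R - 1)) (enum I) (f j) x) <= mean (f j) ^+ 2 * (1 + eps)) ->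
  exists x : 'I_h -> cube, (forall j, f j (x j) != 0) /\
    forall j j', j != j' -> forall i, x j i != x j' i.
Proof.
move=> m1 b0 hbm heps mu0 stab.
have le_c : (#|{: 'I_h * 'I_b}| <= m)%N by rewrite card_prod !card_ord.
pose c (p : 'I_h * 'I_b) : 'I_m := widen_ord le_c (enum_rank p).
have c_inj : injective c.
  by move=> p p' /(congr1 val) /= /val_inj; exact: enum_rank_inj.
pose P j := [set c (j, k) | k : 'I_b].
have cardP j : #|P j| = b.
  by rewrite card_imset ?card_ord // => k k' /c_inj [].
pose Z j := colored_mass (P j) (f j).
have Zle j : \sum_w (Z j w == 0)%:R <= eps * #|{: {ffun I -> {perm 'I_m}}}|%:R.
  by apply: card_coloring_zero_le; rewrite ?cardP.
have W0 : 0 < #|{: {ffun I -> {perm 'I_m}}}|%:R :> R.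
  by rewrite ltr0n; apply/card_gt0P; exists [ffun=> 1%g].
have /existsP[w /forallP Zw] : [exists w, [forall j, Z j w != 0]].
  apply: contraT; rewrite negb_exists => /forallP H.
  have : #|{: {ffun I -> {perm 'I_m}}}|%:R <= \sum_j \sum_w (Z j w == 0)%:R :> R.
    rewrite [leRHS]exchange_big /= -sum1_card natr_sum; apply: ler_sum => w _.
    have := H w; rewrite negb_forall => /existsP[j]; rewrite negbK => Zj.
    by rewrite (bigD1 j) //= Zj lerDl sumr_ge0.
  have S : \sum_j \sum_w (Z j w == 0)%:R <=
      \sum_(j < h) eps * #|{: {ffun I -> {perm 'I_m}}}|%:R :> R.
    by apply: ler_sum => j _; exact: Zle.
  move=> /le_trans /(_ S); rewrite sumr_const card_ord -[eps * _ *+ _]mulr_natl mulrA.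
  by rewrite -[leLHS]mul1r ler_pM2r // leNgt heps.
have ex j : exists x, (f j x != 0) && [forall i, w i (x i) \in P j].
  apply/existsP; apply: contraNT (Zw j); rewrite negb_exists => /forallP H.
  rewrite /Z /colored_mass big1 // => x _; have := H x.
  rewrite negb_and negbK => /orP[/eqP ->|]; first by rewrite mul0r.
  rewrite negb_forall => /existsP[i /negPf wi].
  by rewrite (bigD1 i) //= wi mul0r mulr0.
exists (fun j => xchoose (ex j)); split=> [j|j j' jj' i].
  by case/andP: (xchooseP (ex j)).
have /andP[_ /forallP /(_ i) /imsetP[k _ E]] := xchooseP (ex j).
have /andP[_ /forallP /(_ i) /imsetP[k' _ E']] := xchooseP (ex j').
apply: contraNneq jj' => xx; rewrite xx E' in E.
by have [->] := c_inj _ _ E.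
Qed.

End Coloring.

(** * Disagreeing members and rare values *)

Section Core.
Variables (R : realFieldType) (I : finType) (m : nat).
Hypothesis m_gt0 : (0 < m)%N.
Local Notation cube := {ffun I -> 'I_m}.
Implicit Types (x y z : cube) (f g : cube -> R) (i : I).

Lemma spread_disagreeing p C h w (K : R) (f : 'I_h -> cube -> R) : (0 < C)%N ->
  (forall a X Y : R, 0 <= a -> 0 <= Y -> X ^+ 2 <= 4 * a * Y ->
    (a + X + Y) ^+ p.+2 <=
    a ^+ p.+2 + p.+2%:R * a ^+ p.+1 * X + C%:R * (a ^+ p.+1 * Y + Y ^+ p.+2)) ->
  (128 * C ^ 2 * h.+1 ^ 2 < w)%N -> (w ^ 4 <= m)%N -> (m <= 16 * w ^ 4)%N ->
  1 <= K -> K <= w%:R ->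
  (forall j y, 0 <= f j y <= 1) -> (forall j, 0 < mean (f j)) ->
  (forall j (Q : {set I}) x, av (~: Q) (f j) x <= K ^+ #|Q| * mean (f j)) ->
  (forall j, 1 <= mean (f j) * (2 * w%:R) ^+ p.+2) ->
  exists x : 'I_h -> cube, (forall j, f j (x j) != 0) /\
    forall j j', j != j' -> forall i, x j i != x j' i.
Proof.
move=> C0 expansion wbig mw mw' K1 Kw f01 mu0 spread muw.
have w128 : (128 * h.+1 < w)%N.
  apply: leq_ltn_trans wbig; rewrite -mulnA leq_mul2l /= expnS expn1.
  have C2 : (0 < C ^ 2)%N by rewrite expn_gt0 C0.
  have : (h.+1 * 1 <= h.+1 * h.+1)%N by rewrite leq_mul2l.
  by nia.
have w4 : (w <= w ^ 4)%N by rewrite -{1}(expn1 w) leq_pexp2l //; lia.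
have m1 : (1 < m)%N by lia.
(* The divisor [h.+1] is never zero and leaves room for [h] disjoint blocks; b >= m / (2(h+1)) makes
   the rate at most 4(h+1)/m. *)
set b := (m %/ h.+1)%N.
have b0 : (0 < b)%N by rewrite divn_gt0 //; lia.
have hb : (h * b <= m)%N.
  by apply: leq_trans (leq_divM m h.+1); rewrite mulnC leq_mul2l leqnSn orbT.
have mb : (m <= 2 * h.+1 * b)%N.
  have := divn_eq m h.+1; have := ltn_mod m h.+1; rewrite -/b /=; nia.
have mR : 2 <= m%:R :> R by rewrite ler_nat.
have bR : 1 <= b%:R :> R by rewrite ler1n.
have wR : 1 <= w%:R :> R by rewrite ler1n; lia.
have [H HE] : exists H : R, H = h.+1%:R by exists h.+1%:R.
have H1 : 1 <= H by rewrite HE ler1n.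
set lam : R := (m%:R / b%:R - 1) / (m%:R - 1).
have mb2 : m%:R / b%:R <= 2 * H.
  by rewrite ler_pdivrMr; [rewrite HE -!natrM ler_nat|lra].
have bm : b%:R <= m%:R :> R by rewrite ler_nat leq_div.
have mb1 : 1 <= m%:R / b%:R :> R by rewrite ler_pdivlMr ?mul1r; lra.
have lam0 : 0 <= lam by rewrite divr_ge0; lra.
have lamw : lam * w%:R ^+ 4 <= 4 * H.
  have wm : w%:R ^+ 4 <= m%:R :> R by rewrite -natrX ler_nat.
  apply: le_trans (ler_wpM2l lam0 wm) _.
  rewrite /lam mulrAC ler_pdivrMr; last by lra.
  by nra.
have CC : 1 <= C%:R :> R by rewrite ler1n.
have wb : 128 * C%:R ^+ 2 * H ^+ 2 < w%:R by rewrite HE -!natrX -!natrM ltr_nat.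
have w0 : 0 < w%:R :> R by lra.
have c20 : 0 <= C%:R ^+ 2 :> R by exact: sqr_ge0.
(* As m >= w^4, the relative variance is of order 1/w; [w] beyond 128 C^2 (h+1)^2 lets the union
   bound over the families succeed. *)
have eps_le : (32 * C%:R ^+ 2 * w%:R ^+ 3 * lam) * w%:R <= 128 * C%:R ^+ 2 * H.
  rewrite [leLHS](_ : _ = 32 * C%:R ^+ 2 * (lam * w%:R ^+ 4)); last by ring.
  have := ler_wpM2l c20 lamw; lra.
apply: (@exists_disagreeing R I m m_gt0 h b f (32 * C%:R ^+ 2 * w%:R ^+ 3 * lam)) => //.
  rewrite -(ltr_pM2r w0) mul1r -(mulrA h%:R).
  have h0 : 0 <= h%:R :> R by exact: ler0n.
  have hH : h%:R <= H by rewrite HE ler_nat.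
  apply: le_lt_trans wb; apply: le_trans (ler_wpM2l h0 eps_le) _.
  rewrite [leRHS](_ : _ = H * (128 * C%:R ^+ 2 * H)); last by ring.
  by rewrite ler_wpM2r // !mulr_ge0 //; lra.
move=> j; apply: (small_noise_stability m_gt0 C0 expansion (f01 j) K1 Kw) => //.
have w20 : 0 < w%:R ^+ 2 :> R by rewrite exprn_gt0.
rewrite -/lam -(ler_pM2r w20) mul1r.
rewrite [leLHS](_ : _ = 16 * C%:R ^+ 2 * (lam * w%:R ^+ 4)); last by ring.
apply: (@le_trans _ _ w%:R); last by rewrite expr2 ler_peMl // ltW.
apply: le_trans (ltW wb).
have := ler_wpM2l c20 lamw; have : 0 <= C%:R ^+ 2 * (H ^+ 2 - H).
  by rewrite mulr_ge0 // subr_ge0 expr2 ler_peMl; lra.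
by nra.
Qed.

(** * Rare values at a coordinate *)

Definition density f i (a : 'I_m) : R := av (~: [set i]) f [ffun=> a].

Lemma densityE f i x : av (~: [set i]) f x = density f i (x i).
Proof.
rewrite /density -(av_overwrite _ f x [ffun=> x i]); congr (av _ _ _).
by apply/ffunP=> j; rewrite !ffunE !inE; case: eqP => //= ->.
Qed.

Lemma mean_density f i a : mean (fun x => f x * (x i == a)%:R) = m%:R^-1 * density f i a.
Proof.
rewrite -(mean_av m_gt0 (~: [set i])).
have E : av (~: [set i]) (fun x => (x i == a)%:R : R) = fun x => (x i == a)%:R.
  apply: functional_extensionality => x; rewrite avE.
  under eq_bigr => y _ do rewrite ffunE !inE eqxx /=.
  by rewrite sumr_const -[(_ == _)%:R *+ _]mulr_natl mulrA mulVf ?mul1r // card_cube_neq0.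
have -> : (fun x => f x * (x i == a)%:R) = (fun x => (x i == a)%:R * f x).
  by apply: functional_extensionality => x; rewrite mulrC.
rewrite (av_indep _ E) -(mean_eq R m_gt0 i a) mulrC -meanZ; congr mean.
apply: functional_extensionality => x; rewrite densityE mulrC.
by case: eqP => [->|]; rewrite ?mulr0 ?mulr1.
Qed.

(** A supporting line, at c = t and on the integers, of the convex function 2^-c. *)
Lemma half_power_ge (c t : nat) :
  (2^-1) ^+ t * (1 + t%:R - c%:R) <= (2^-1) ^+ c :> R.
Proof.
have h0 : 0 <= (2^-1 : R) by rewrite invr_ge0 ler0n.
have [ct|/ltnW tc] := leqP c t; last first.
  have [->|tc'] := eqVneq c t; first by rewrite addrK mulr1.
  apply: (@le_trans _ _ 0); last by rewrite exprn_ge0.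
  rewrite mulr_ge0_le0 ?exprn_ge0 // subr_le0 addrC natr1 ler_nat.
  by rewrite ltn_neqAle eq_sym tc' tc.
rewrite -(subnKC ct) exprD -mulrA ler_piMr ?exprn_ge0 // natrD addrAC addrA.
rewrite [X in _ * (X + _)](_ : _ = 1); last by ring.
elim: (t - c)%N => [|d IH]; first by rewrite mul1r addr0.
apply: le_trans IH; rewrite exprSr -mulrA ler_wpM2l ?exprn_ge0 //.
have : 0 <= d%:R :> R by []. 
rewrite -(natr1 d); lra.
Qed.

Lemma power_two_le_half (n : nat) : (0 < n)%N -> (1 - n%:R^-1) ^+ n <= 2^-1 :> R.
Proof.
case: n => // n _; set u := 1 - _.
have n0 : n.+1%:R != 0 :> R by rewrite pnatr_eq0.
have u0 : 0 <= u by rewrite /u subr_ge0 invf_le1 ?ltr0n // ler1n.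
have u1 : u <= 1 by rewrite /u lerBlDr lerDl invr_ge0 ler0n.
have := power_tangent n ler01 u0; rewrite expr1n.
have -> : n.+1%:R * u ^+ n * (1 - u) = u ^+ n.
  by rewrite {2}/u opprB addrC subrK mulrAC divff // mul1r.
have : u ^+ n.+1 <= u ^+ n by rewrite exprS ler_piMl ?exprn_ge0.
lra.
Qed.

(* Compares the mean of [2 ^- cnt], where [cnt] counts the coordinates in [J] with
   a value in [U], under [f] (by convexity) and under the uniform measure (by
   independence). *)
Lemma rare_values_mean_le f (J : {set I}) (U : I -> {set 'I_m}) (g t c : nat) :
  (forall y, 0 <= f y <= 1) -> (0 < g)%N -> (m <= g * c)%N -> (g * c <= 2 * m)%N ->
  #|J| = (8 * g * t)%N -> (forall i, i \in J -> #|U i| = c) ->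
  (forall i a, i \in J -> a \in U i -> density f i a <= mean f / 16) ->
  mean f * 8 ^+ t <= 1.
Proof.
move=> f01 g0 mc cm cardJ cardU rare.
have f0 y : 0 <= f y by case/andP: (f01 y).
have mu0 : 0 <= mean f by exact: mean_ge0.
have mR : 0 < m%:R :> R by rewrite ltr0n.
have gR : 0 < g%:R :> R by rewrite ltr0n.
pose cnt x := (\sum_(i in J) (x i \in U i))%N.
(* Under [f] the count averages at most |J| c / (16 m) = t (g c) / (2 m) <= t; the 8 in |J| and the
   16 defining rarity are matched for this. *)
have Efc : mean (fun x => f x * (cnt x)%:R) <= t%:R * mean f.
  have -> : (fun x => f x * (cnt x)%:R) =
      (fun x => \sum_i \sum_a ((i \in J) && (a \in U i))%:R * (f x * (x i == a)%:R)).
    apply: functional_extensionality => x; rewrite natr_sum mulr_sumr big_mkcond /=.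
    apply: eq_bigr => i _; rewrite (bigD1 (x i)) //= eqxx mulr1 big1 ?addr0.
      by case: (i \in J); rewrite ?mul0r // mulrC.
    by move=> a; rewrite eq_sym => /negPf ->; rewrite !mulr0.
  rewrite mean_bigsum; under eq_bigr => i _ do rewrite mean_bigsum.
  under eq_bigr => i _ do under eq_bigr => a _ do rewrite meanZ mean_density.
  apply: (@le_trans _ _ (\sum_(i in J) \sum_(a in U i) (m%:R^-1 * (mean f / 16)))).
    rewrite [leRHS]big_mkcond /=; apply: ler_sum => i _; case: ifP => iJ; last first.
      by rewrite big1 // => a _; rewrite mul0r.
    rewrite [leRHS]big_mkcond /=; apply: ler_sum => a _; case: ifP => aU; rewrite ?mul0r //.
    by rewrite mul1r ler_wpM2l ?invr_ge0 ?ler0n // rare.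
  under eq_bigr => i iJ do rewrite sumr_const cardU //.
  rewrite sumr_const cardJ -mulrnA -[leLHS]mulr_natl.
  rewrite [leLHS](_ : _ = (m%:R^-1 / 2 * (g * c)%:R) * (t%:R * mean f)); last first.
    by rewrite !natrM; field; rewrite gt_eqF.
  rewrite ler_piMl ?mulr_ge0 ?ler0n //.
  rewrite [leLHS](_ : _ = (g * c)%:R / (2 * m%:R)); last by field; rewrite gt_eqF.
  by rewrite ler_pdivrMr ?mulr_gt0 // mul1r -natrM ler_nat.
have Elow : (2^-1) ^+ t * mean f <= mean (fun x => f x * (2^-1) ^+ cnt x).
  have t0 : 0 <= (2^-1 : R) ^+ t by rewrite exprn_ge0 // invr_ge0.
  apply: (@le_trans _ _ ((2^-1) ^+ t * ((1 + t%:R) * mean f - mean (fun x => f x * (cnt x)%:R)))).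
    by rewrite ler_wpM2l //; lra.
  rewrite -meanZ -meanB -meanZ; apply: mean_le => x.
  apply: le_trans (ler_wpM2l (f0 x) (half_power_ge (cnt x) t)).
  by rewrite le_eqVlt; apply/orP; left; apply/eqP; ring.
(* Under the uniform measure each coordinate of [J] contributes 1 - c/(2m) <= 1 - 1/(2g), and the
   power 2g of the latter is at most 1/2. *)
have Eup : mean (fun x => f x * (2^-1) ^+ cnt x) <= (2^-1) ^+ (4 * t).
  apply: (@le_trans _ _ (mean (fun x => \prod_i (if (i \in J) && (x i \in U i) then 2^-1 else 1)))).
    apply: mean_le => x.
    have -> : \prod_i (if (i \in J) && (x i \in U i) then 2^-1 else 1 : R) = (2^-1) ^+ cnt x.
      rewrite /cnt expr_sum [RHS]big_mkcond /=; apply: eq_bigr => i _.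
      by case: (i \in J); case: (x i \in U i).
    rewrite ler_piMl ?exprn_ge0 ?invr_ge0 //; by case/andP: (f01 x).
  rewrite (mean_prod (fun i a => if (i \in J) && (a \in U i) then 2^-1 else 1)).
  have -> : \prod_i (m%:R^-1 * \sum_a (if (i \in J) && (a \in U i) then 2^-1 else 1 : R)) =
      (1 - c%:R / (2 * m%:R)) ^+ #|J|.
    rewrite -prodr_const [RHS]big_mkcond /=; apply: eq_bigr => i _.
    case: ifP => iJ /=; last by rewrite sumr_const card_ord mulVf // gt_eqF.
    rewrite (eq_bigr (fun a => 1 - 2^-1 * (a \in U i)%:R)) => [|a _]; last first.
      by case: ifP => _; rewrite ?mulr1 ?mulr0 ?subr0 //; field.
    rewrite sumrB sumr_const card_ord -mulr_sumr -natr_sum -big_mkcond sum1_card cardU //.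
    by field; rewrite gt_eqF.
  have g2 : (0 < 2 * g)%N by rewrite muln_gt0.
  have cR : c%:R <= 2 * m%:R :> R.
    by rewrite -natrM ler_nat; apply: leq_trans cm; rewrite leq_pmull.
  have gm : (2 * g)%:R^-1 <= c%:R / (2 * m%:R) :> R.
    rewrite natrM -[_^-1]mul1r ler_pdivrMr ?mulr_gt0 // mulrAC ler_pdivlMr ?mulr_gt0 // mul1r.
    by rewrite -!natrM ler_nat [leqRHS]mulnCA leq_mul2l orbC [(c * g)%N]mulnC mc.
  have q0 : 0 <= 1 - c%:R / (2 * m%:R) :> R by rewrite subr_ge0 ler_pdivrMr ?mul1r ?mulr_gt0.
  have q1 : 1 - c%:R / (2 * m%:R) <= 1 - (2 * g)%:R^-1 :> R by rewrite lerB.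
  rewrite cardJ (_ : 8 * g * t = 2 * g * (4 * t))%N; last by lia.
  rewrite exprM; apply: lerXn2r; rewrite ?nnegrE ?exprn_ge0 ?invr_ge0 //.
  apply: le_trans (power_two_le_half g2).
  by apply: lerXn2r => //; rewrite nnegrE; apply: le_trans q1.
have := le_trans Elow Eup.
rewrite [(4 * t)%N](_ : _ = t + 3 * t)%N; last by lia.
have h0 : 0 < (2^-1 : R) ^+ t by rewrite exprn_gt0 // invr_gt0.
rewrite exprD ler_pM2l // exprM => H.
have -> : (8 : R) ^+ t = ((2^-1) ^+ 3 ^+ t)^-1 by rewrite -exprVn; congr (_ ^+ _); field.
by rewrite ler_pdivrMr ?mul1r // exprn_gt0 // exprn_gt0 // invr_gt0.
Qed.

Definition rare f i : {set 'I_m} := [set a | density f i a <= mean f / 16].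

Lemma card_take_enum (T : finType) (A : {set T}) n : (n <= #|A|)%N ->
  [set a in take n (enum A)] \subset A /\ #|[set a in take n (enum A)]| = n.
Proof.
move=> nA; split; first by apply/subsetP=> a; rewrite inE => /mem_take; rewrite mem_enum.
have /card_uniqP : uniq (take n (enum A)) by rewrite take_uniq ?enum_uniq.
by rewrite cardsE size_take -cardE => ->; case: ltngtP nA.
Qed.

Lemma few_rare_coordinates f (g t c : nat) : (forall y, 0 <= f y <= 1) ->
  (0 < g)%N -> (m <= g * c)%N -> (g * c <= 2 * m)%N -> 1 < mean f * 8 ^+ t ->
  (#|[set i | (c <= #|rare f i|)%N]| < 8 * g * t)%N.
Proof.
move=> f01 g0 mc cm big; rewrite ltnNge; apply/negP => /card_take_enum.
set J := [set a in _]; case=> sJ cardJ.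
pose U i := [set a in take c (enum (rare f i))].
have UP i : i \in J -> U i \subset rare f i /\ #|U i| = c.
  by move=> iJ; apply: card_take_enum; have := subsetP sJ i iJ; rewrite inE.
have : mean f * 8 ^+ t <= 1; last by rewrite leNgt big.
apply: (rare_values_mean_le (U := U) f01 g0 mc cm cardJ) => [i iJ|i a iJ aU].
  by case: (UP i iJ).
by have [/subsetP/(_ a aU)] := UP i iJ; rewrite inE.
Qed.

End Core.

(** * Restrictions and greedy choices *)

Lemma card_bigcup_le (J T : finType) (P : pred J) (F : J -> {set T}) :
  (#|\bigcup_(j | P j) F j| <= \sum_(j | P j) #|F j|)%N.
Proof.
elim/big_rec2: _ => [|j n A _ IH]; first by rewrite cards0.
by apply: leq_trans (leq_card_setU _ _) _; rewrite leq_add2l.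
Qed.

(** The condition at [j] reads the choices below [j] only, so a total function with arbitrary later
    values can stand for a partial choice. *)
Lemma greedy_choice (h : nat) (X : Type) (x0 : X) (P : 'I_h -> ('I_h -> X) -> X -> Prop) :
  (forall (j : 'I_h) u u' x, (forall i : 'I_h, (i < j)%N -> u i = u' i) ->
     P j u x -> P j u' x) ->
  (forall (j : 'I_h) u, (forall i : 'I_h, (i < j)%N -> P i u (u i)) -> exists x, P j u x) ->
  exists u, forall j, P j u (u j).
Proof.
move=> loc step.
have: forall t, (t <= h)%N -> exists u, forall j : 'I_h, (j < t)%N -> P j u (u j).
  elim=> [|t IH] th; first by exists (fun=> x0).
  have [u uP] := IH (ltnW th); pose jt := Ordinal th.
  have [x xP] := step jt u (fun i it => uP i it).
  exists (fun j => if j == jt then x else u j) => j; rewrite ltnS => jle.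
  apply: (loc _ u) => [i ij|].
    by case: eqP => // ijt; move: ij; rewrite ijt /= ltnNge jle.
  case: eqP => [->|jne] //; apply: uP; rewrite ltn_neqAle jle andbT.
  by apply: contra_not_neq jne => jt'; exact: val_inj.
move=> /(_ h (leqnn h)) [u uP]; exists u => j; exact: uP.
Qed.

Lemma exists_injection (m : nat) (L : finType) (A : {set 'I_m}) : (#|L| <= #|A|)%N ->
  exists2 phi : L -> 'I_m, injective phi & forall v, phi v \in A.
Proof.
move=> LA; exists (fun v => enum_val (widen_ord LA (enum_rank v))) => [v v' /enum_val_inj|v].
  by move=> /(congr1 val) /= /val_inj /enum_rank_inj.
exact: enum_valP.
Qed.

(** * Restrictions, avoidance and planted agreements *)

Section Restriction.
Variables (R : realFieldType) (I : finType) (m : nat).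
Hypothesis m_gt0 : (0 < m)%N.
Local Notation cube := {ffun I -> 'I_m}.
Implicit Types (x y z : cube) (f g : cube -> R) (i : I) (Q S : {set I}).

(** Frozen coordinates stay in the cube as dummies, so differently restricted families remain
    functions on one cube. *)
Definition freeze S z f : cube -> R := fun y => f (overwrite S y z).

Lemma av_agree Q f x y : {in Q, x =1 y} -> av (~: Q) f x = av (~: Q) f y.
Proof.
move=> xy; rewrite -(av_overwrite _ f x y); congr (av _ _ _).
by apply/ffunP=> i; rewrite ffunE inE; case: (boolP (i \in Q)) => //= /xy.
Qed.

Lemma av_freeze Q S z f x :
  av (~: Q) (freeze S z f) x = av (~: (Q :|: S)) f (overwrite S x z).
Proof.
rewrite !avE; congr (_ * _); apply: eq_bigr => y _; rewrite /freeze; congr (f _).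
apply/ffunP=> i; rewrite !ffunE !inE.
by case: (i \in S); case: (i \in Q).
Qed.

Lemma mean_freeze S z f : mean (freeze S z f) = av (~: S) f z.
Proof.
rewrite (meanE _ z) -setC0 av_freeze set0U; apply: av_agree => i iS.
by rewrite ffunE iS.
Qed.

(* Take the restriction maximising its mean divided by [K ^+ #|S|]. *)
Lemma spread_restriction f (K : R) : 1 <= K -> (forall y, 0 <= f y) ->
  exists S z, mean f * K ^+ #|S| <= mean (freeze S z f) /\
    forall Q x, av (~: Q) (freeze S z f) x <= K ^+ #|Q| * mean (freeze S z f).
Proof.
move=> K1 f0; have K0 : 0 < K by exact: lt_le_trans K1.
pose z0 : cube := [ffun=> Ordinal m_gt0].
pose F (p : {set I} * cube) := av (~: p.1) f p.2 / K ^+ #|p.1|.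
pose p := [arg max_(p > (set0, z0) | xpredT p) F p]%O.
have pmax q : F q <= F p by rewrite /p; case: Order.TotalTheory.arg_maxP => // p' _; apply.
exists p.1, p.2; rewrite mean_freeze.
have mu0 : 0 <= av (~: p.1) f p.2 by exact: av_ge0.
split=> [|Q x].
  have := pmax (set0, z0); rewrite /F /= cards0 expr0 divr1 setC0 -meanE.
  by rewrite ler_pdivlMr ?exprn_gt0.
rewrite av_freeze; have := pmax (Q :|: p.1, overwrite p.1 x p.2).
rewrite /F /= ler_pdivrMr ?exprn_gt0 // => /le_trans; apply.
rewrite mulrAC ler_pdivrMr ?exprn_gt0 // mulrC mulrAC ler_wpM2r // -exprD.
by rewrite ler_weXn2l // cardsU leq_subr.
Qed.

Definition avoids (D : {set I * 'I_m}) x : bool := [forall p in D, x p.1 != p.2].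

(** Union bound: each dictator removes at most K/m of the density. *)
Lemma mean_avoids_ge f (D : {set I * 'I_m}) (K : R) : (forall y, 0 <= f y) ->
  (forall i a, density f i a <= K * mean f) -> 2 * #|D|%:R * K <= m%:R ->
  mean f <= 2 * mean (fun x => f x * (avoids D x)%:R).
Proof.
move=> f0 fK DK.
have mR : 0 < m%:R :> R by rewrite ltr0n.
have mu0 : 0 <= mean f by exact: mean_ge0.
have H : mean f - \sum_(p in D) m%:R^-1 * density f p.1 p.2
    <= mean (fun x => f x * (avoids D x)%:R).
  have -> : \sum_(p in D) m%:R^-1 * density f p.1 p.2 =
      mean (fun x => \sum_p (p \in D)%:R * (f x * (x p.1 == p.2)%:R)).
    rewrite mean_bigsum big_mkcond /=; apply: eq_bigr => p _.
    by rewrite meanZ mean_density //; case: ifP; rewrite ?mul1r ?mul0r.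
  rewrite -meanB; apply: mean_le => x; rewrite lerBlDr.
  have S0 p : 0 <= (p \in D)%:R * (f x * (x p.1 == p.2)%:R) by rewrite !mulr_ge0 ?ler0n.
  case: (boolP (avoids D x)) => [_|]; first by rewrite mulr1 lerDl sumr_ge0.
  rewrite negb_forall => /existsP[p]; rewrite negb_imply negbK => /andP[pD xp].
  by rewrite mulr0 add0r (bigD1 p) //= pD xp mul1r mulr1 lerDl sumr_ge0.
have S : \sum_(p in D) m%:R^-1 * density f p.1 p.2 <= 2^-1 * mean f.
  apply: (@le_trans _ _ (\sum_(p in D) m%:R^-1 * (K * mean f))).
    by apply: ler_sum => p _; rewrite ler_wpM2l ?invr_ge0 ?ler0n.
  rewrite sumr_const -[leLHS]mulr_natl.
  rewrite [leLHS](_ : _ = (#|D|%:R * K / m%:R) * mean f); last by ring.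
  by rewrite ler_wpM2r // ler_pdivrMr //; lra.
lra.
Qed.

(** Few coordinates have [c] or more rare values for some family, so a fresh one remains. There at
    least m - h c >= |L| values are rare for no family; labels are sent injectively to them, and
    each freeze divides a density by at most 16. *)
Lemma popular_coordinates (h l : nat) (L : finType) (label : 'I_h -> 'I_l -> L)
    (G : 'I_h -> cube -> R) (X : {set I}) (g t c : nat) :
  (forall j y, 0 <= G j y <= 1) ->
  (0 < g)%N -> (m <= g * c)%N -> (g * c <= 2 * m)%N ->
  (forall j, 16 ^+ l < mean (G j) * 8 ^+ t) ->
  (#|X| + l + h * (8 * g * t) < #|I|)%N -> (h * c + #|L| <= m)%N ->
  exists (Phi : 'I_l -> I) (phi : 'I_l -> L -> 'I_m) (z : 'I_h -> cube),
    [/\ injective Phi, forall k, Phi k \notin X, forall k, injective (phi k),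
      forall j k, z j (Phi k) = phi k (label j k) &
      forall j, mean (G j) <= 16 ^+ l * mean (freeze [set Phi k | k : 'I_l] (z j) (G j))].
Proof.
move=> G01 g0 mc cm big room hcL.
have mu0 j : 0 <= mean (G j) by apply: mean_ge0 => // y; case/andP: (G01 j y).
pose z0 : cube := [ffun=> Ordinal m_gt0].
have I0 : (0 < #|I|)%N by exact: leq_ltn_trans room.
have [i00 _] := card_gt0P I0.
have: forall s, (s <= l)%N ->
  exists (Phi : 'I_l -> I) (phi : 'I_l -> L -> 'I_m) (z : 'I_h -> cube),
    [/\ {in [pred k : 'I_l | (k < s)%N] &, injective Phi},
      forall k : 'I_l, (k < s)%N -> Phi k \notin X,
      forall k : 'I_l, (k < s)%N -> injective (phi k),
      forall j (k : 'I_l), (k < s)%N -> z j (Phi k) = phi k (label j k) &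
      forall j, mean (G j) <=
        16 ^+ s * mean (freeze [set Phi k | k : 'I_l & (k < s)%N] (z j) (G j))].
  elim=> [|s IH] sl.
    exists (fun=> i00), (fun _ _ => Ordinal m_gt0), (fun=> z0); split=> // j.
    rewrite expr0 mul1r [X in freeze X](_ : _ = set0) ?mean_freeze.
      by rewrite setC0 -meanE.
    by apply/setP=> i; rewrite inE; apply/imsetP => -[k]; rewrite inE.
  have [Phi [phi [z [Phi_inj PhiX phi_inj zP meanP]]]] := IH (ltnW sl).
  set Q := [set Phi k | k : 'I_l & (k < s)%N] in meanP.
  pose F j := freeze Q (z j) (G j).
  have F01 j y : 0 <= F j y <= 1 by exact: G01.
  have bigF j : 1 < mean (F j) * 8 ^+ t.
    have s16 : 0 < 16 ^+ s :> R by rewrite exprn_gt0.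
    rewrite -(ltr_pM2l s16) mulr1; apply: (@le_lt_trans _ _ (16 ^+ l)).
      by rewrite ler_weXn2l ?(ltnW sl) //; lra.
    by apply: lt_le_trans (big j) _; rewrite mulrA ler_wpM2r ?exprn_ge0.
  pose bad j := [set i | (c <= #|rare (F j) i|)%N].
  have card_bad j : (#|bad j| <= 8 * g * t)%N by apply: ltnW; exact: few_rare_coordinates.
  have Ql : (#|Q| <= l)%N.
    apply: leq_trans (leq_imset_card _ _) _.
    by apply: leq_trans (max_card _) _; rewrite card_ord.
  have [i0 i0P] : exists i, i \notin X :|: Q :|: \bigcup_j bad j.
    apply/existsP; apply: contraTT room; rewrite negb_exists -leqNgt => /forallP H.
    have -> : #|I| = #|X :|: Q :|: \bigcup_j bad j|.
      by rewrite -cardsT; apply: eq_card => i; rewrite inE -[RHS]negbK (negbTE (H i)).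
    apply: leq_trans (leq_card_setU _ _) (leq_add _ _).
      by apply: leq_trans (leq_card_setU _ _) _; rewrite leq_add2l.
    apply: leq_trans (card_bigcup_le _ _) _.
    rewrite -[h in leqRHS]card_ord -sum_nat_const; apply: leq_sum => j _; exact: card_bad.
  move: i0P; rewrite !inE !negb_or -andbA => /and3P[i0X i0Q /bigcupP i0bad].
  have rare_lt j : (#|rare (F j) i0| < c)%N.
    rewrite ltnNge; apply/negP => H; apply: i0bad; exists j => //; by rewrite inE.
  have [phi0 phi0_inj phi0P] : exists2 phi : L -> 'I_m, injective phi &
      forall v, phi v \in ~: \bigcup_j rare (F j) i0.
    apply: exists_injection; rewrite cardsCs setCK card_ord leq_subRL.
      apply: leq_trans hcL; rewrite leq_add2r; apply: leq_trans (card_bigcup_le _ _) _.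
      rewrite -[h in leqRHS]card_ord -sum_nat_const; apply: leq_sum => j _.
      exact: ltnW.
    by rewrite -[leqRHS](card_ord m) max_card.
  pose ks := Ordinal sl.
  have ltk (k : 'I_l) : (k < s.+1)%N -> k != ks -> (k < s)%N.
    by rewrite ltnS ltn_neqAle => -> kks; rewrite andbT; apply: contra kks => /eqP kE; apply/eqP/val_inj.
  have PhiQ (k : 'I_l) : (k < s)%N -> Phi k \in Q by move=> ks'; rewrite imset_f // inE.
  have Phine (k : 'I_l) : (k < s)%N -> Phi k != i0.
    by move=> /PhiQ kQ; apply: contraNneq i0Q => <-.
  exists (fun k => if k == ks then i0 else Phi k), (fun k => if k == ks then phi0 else phi k),
    (fun j => upd (z j) i0 (phi0 (label j ks))).
  split.
  - move=> k k'; rewrite !inE => ks1 ks1'.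
    case: (altP (k =P ks)) => [->|kn]; case: (altP (k' =P ks)) => [->|kn'] // E.
    + by have := Phine k' (ltk _ ks1' kn'); rewrite E eqxx.
    + by have := Phine k (ltk _ ks1 kn); rewrite E eqxx.
    + by apply: Phi_inj E; rewrite inE ltk.
  - by move=> k ks1; case: (altP (k =P ks)) => // kn; exact: PhiX (ltk _ ks1 kn).
  - by move=> k ks1; case: (altP (k =P ks)) => // kn; exact: phi_inj (ltk _ ks1 kn).
  - move=> j k ks1; rewrite ffunE; case: (altP (k =P ks)) => [->|kn]; first by rewrite eqxx.
    by rewrite (negPf (Phine k (ltk _ ks1 kn))) zP ?ltk.
  move=> j; apply: le_trans (meanP j) _; rewrite exprSr -mulrA ler_wpM2l ?exprn_ge0 //.
  have := phi0P (label j ks); rewrite inE => /bigcupP H.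
  have : mean (F j) / 16 < density (F j) i0 (phi0 (label j ks)).
    rewrite ltNge; apply/negP => H'; apply: H; exists j => //; by rewrite inE.
  rewrite /density av_freeze -/(F j).
  set Q' := (X in freeze X).
  have -> : Q' = [set i0] :|: Q.
    apply/setP=> i; rewrite !inE; apply/imsetP/orP => [[k]|].
      rewrite inE; case: (altP (k =P ks)) => [_ _ ->|kn ks1 ->]; first by left.
      by right; apply: PhiQ; exact: ltk.
    case=> [/eqP ->|/imsetP[k]]; first by exists ks; rewrite ?inE ?eqxx //=.
    rewrite inE => ks' ->; exists k; rewrite ?inE ?(ltnW ks') ?ltnS ?(ltnW ks') //.
    by case: eqP => // kE; rewrite kE /= ltnn in ks'.
  rewrite mean_freeze; set zd := overwrite Q _ _; set zu := upd _ _ _.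
  have -> : av (~: ([set i0] :|: Q)) (G j) zu = av (~: ([set i0] :|: Q)) (G j) zd; last by lra.
  apply: av_agree => i; rewrite !inE !ffunE => /orP[/eqP ->|iQ]; first by rewrite eqxx (negPf i0Q).
  by rewrite iQ; case: (i =P i0) => // ii0; rewrite -ii0 iQ in i0Q.
move=> /(_ l (leqnn l)) [Phi [phi [z [Phi_inj PhiX phi_inj zP meanP]]]].
exists Phi, phi, z; split=> [k k' E|k|k|j k|j]; rewrite ?PhiX ?zP ?ltn_ord //.
- by apply: Phi_inj E; rewrite inE ltn_ord.
- exact: phi_inj.
have -> : [set Phi k | k : 'I_l] = [set Phi k | k : 'I_l & (k < l)%N]; last exact: meanP.
by apply/setP=> i; apply/imsetP/imsetP => -[k _ ->]; exists k; rewrite ?inE.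
Qed.

End Restriction.

(** * Realisation in the cube *)

Section Realisation.
Variables (R : realFieldType) (I : finType) (m : nat).
Hypothesis m_gt0 : (0 < m)%N.
Local Notation cube := {ffun I -> 'I_m}.

Definition dictators (S : {set I}) (z : cube) : {set I * 'I_m} := [set (i, z i) | i in S].

Lemma avoids_bigcup (J : finType) (P : pred J) (D : J -> {set I * 'I_m}) (x : cube) j :
  avoids (\bigcup_(j | P j) D j) x -> P j -> avoids (D j) x.
Proof.
move=> /forall_inP H Pj; apply/forall_inP => q qD; apply: H.
by apply/bigcupP; exists j.
Qed.

Lemma avoids_dictators S (z x : cube) i : avoids (dictators S z) x -> i \in S -> x i != z i.
Proof. by move=> /forall_inP H iS; exact: (H (i, z i) (imset_f _ iS)). Qed.

Lemma card_dictators_bigcup h d (P : pred 'I_h) (S : 'I_h -> {set I}) (z : 'I_h -> cube) :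
  (forall j, P j -> #|S j| <= d)%N ->
  (#|\bigcup_(j | P j) dictators (S j) (z j)| <= h * d)%N.
Proof.
move=> Sd; apply: leq_trans (card_bigcup_le _ _) _.
apply: leq_trans (_ : \sum_(j | P j) d <= _)%N.
  by apply: leq_sum => j Pj; apply: leq_trans (leq_imset_card _ _) (Sd j Pj).
rewrite sum_nat_const leq_mul2r; apply/orP; right.
by apply: leq_trans (max_card _) _; rewrite card_ord.
Qed.

(** All families share one cube; nothing is prescribed on [T], and the density hypothesis
    accordingly concerns dictators outside [T]. *)
Lemma cube_realisation (h l : nat) (L : finType) (label : 'I_h -> 'I_l -> L)
    (B : 'I_h -> {set cube}) (T : {set I}) (p C w K g t c d : nat) (delta : R) :
  (0 < C)%N ->
  (forall a X Y : R, 0 <= a -> 0 <= Y -> X ^+ 2 <= 4 * a * Y ->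
    (a + X + Y) ^+ p.+2 <=
    a ^+ p.+2 + p.+2%:R * a ^+ p.+1 * X + C%:R * (a ^+ p.+1 * Y + Y ^+ p.+2)) ->
  (128 * C ^ 2 * h.+1 ^ 2 < w)%N -> (w ^ 4 <= m)%N -> (m <= 16 * w ^ 4)%N ->
  (0 < K)%N -> (2 * 16 ^ l * K ^ l.+1 <= w)%N -> (2 * (h * d) * K <= m)%N ->
  0 < delta -> 1 <= K%:R ^+ d.+1 * delta ->
  (0 < g)%N -> (m <= g * c)%N -> (g * c <= 2 * m)%N -> 2 * 16 ^+ l <= delta * 8 ^+ t ->
  (#|T| + h * d + l + h * (8 * g * t) < #|I|)%N -> (h * c + #|L| <= m)%N ->
  2 * 16 ^+ l <= delta * (2 * w%:R) ^+ p.+2 ->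
  (forall j (D : {set I * 'I_m}), (#|D| <= h * d)%N -> (forall q, q \in D -> q.1 \notin T) ->
    delta < mean (fun x => ((x \in B j) && avoids D x)%:R)) ->
  exists (y : 'I_h -> cube) (Phi : 'I_l -> I),
    [/\ injective Phi, forall k, Phi k \notin T, forall j, y j \in B j &
      forall j j', j != j' -> forall i, i \notin T ->
        (y j i == y j' i) = [exists k, (i == Phi k) && (label j k == label j' k)]].
Proof.
move=> C0 expansion wbig mw mw' K0 Kw hdK delta0 Kd g0 mc cm d8 room hcL dw H.
have K1 : 1 <= K%:R :> R by rewrite ler1n.
have h0 (b : bool) : 0 <= (b%:R : R) <= 1 by case: b; rewrite ?ler01 ?lexx.
pose z0 : cube := [ffun=> Ordinal m_gt0].
pose X := ({set I} * cube)%type.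
pose D (j : 'I_h) (u : 'I_h -> X) :=
  \bigcup_(j' : 'I_h | (j' < j)%N) dictators ((u j').1 :\: T) (u j').2.
pose f j u x : R := ((x \in B j) && avoids (D j u) x)%:R.
pose F j u (s : X) := freeze s.1 s.2 (f j u).
pose P j u (s : X) := [/\ (#|s.1| <= d)%N, delta < mean (F j u s) &
  forall Q x, av (~: Q) (F j u s) x <= K%:R ^+ #|Q| * mean (F j u s)].
have [u uP] : exists u, forall j, P j u (u j).
  apply: (greedy_choice (set0, z0)) => [j u u' s uu'|j u uP].
    have DE : D j u = D j u' by apply: eq_bigr => j' /uu' ->.
    by rewrite /P /F /f DE.
  have cardD : (#|D j u| <= h * d)%N.
    apply: card_dictators_bigcup => j' /uP[Sd _ _].
    by apply: leq_trans Sd; rewrite subset_leq_card // subsetDl.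
  have DT q : q \in D j u -> q.1 \notin T.
    by case/bigcupP => j' _ /imsetP[i]; rewrite inE => /andP[iT _] ->.
  have big := H j (D j u) cardD DT.
  have [|S [z [le_mean spread]]] := @spread_restriction _ _ _ m_gt0 (f j u) K%:R K1.
    by move=> y; case/andP: (h0 ((y \in B j) && avoids (D j u) y)).
  have fge0 : 0 <= mean (f j u) by exact: le_trans (ltW delta0) (ltW big).
  exists (S, z); split=> //=; last first.
    apply: lt_le_trans big _; apply: le_trans le_mean; rewrite ler_peMr //.
    exact: exprn_ege1.
  (* Each frozen coordinate gains a factor [K], so more than [d] of them would push the density
     above 1. *)
  rewrite leqNgt; apply/negP => dS.
  have F1 : mean (freeze S z (f j u)) <= 1.
    rewrite -[leRHS](mean_cst I m_gt0) //; apply: mean_le => y.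
    by case/andP: (h0 ((overwrite S y z \in B j) && avoids (D j u) (overwrite S y z))).
  have : K%:R ^+ d.+1 * delta < 1.
    apply: lt_le_trans F1; apply: lt_le_trans le_mean; rewrite mulrC.
    apply: lt_le_trans (_ : mean (f j u) * K%:R ^+ d.+1 <= _).
      by rewrite ltr_pM2r // exprn_gt0 // (lt_le_trans ltr01).
    by rewrite ler_wpM2l // ler_weXn2l.
  by rewrite ltNge Kd.
pose S j := (u j).1; pose al j := (u j).2.
have Sd j : (#|S j| <= d)%N by case: (uP j).
pose Ff j := F j u (u j).
have Fdelta j : delta < mean (Ff j) by case: (uP j).
have Fspread j Q x : av (~: Q) (Ff j) x <= K%:R ^+ #|Q| * mean (Ff j) by case: (uP j).
have F01 j y : 0 <= Ff j y <= 1 by exact: h0.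
(* All restrictions are now known, and the free coordinates of each family can avoid the values
   fixed by every other one, at the cost of at most half the density. *)
pose E j := \bigcup_(j' | j' != j) dictators (S j') (al j').
have cardE j : (#|E j| <= h * d)%N by apply: card_dictators_bigcup => j' _.
pose G j x := Ff j x * (avoids (E j) x)%:R.
have G01 j y : 0 <= G j y <= 1.
  have /andP[F0 F1] := F01 j y; have /andP[a0 a1] := h0 (avoids (E j) y).
  by apply/andP; split; [exact: mulr_ge0|exact: mulr_ile1].
have FG j : mean (Ff j) <= 2 * mean (G j).
  apply: (@mean_avoids_ge _ _ _ m_gt0 (Ff j) (E j) K%:R) => [y|i a|].
  - by case/andP: (F01 j y).
  - by have := Fspread j [set i] [ffun=> a]; rewrite cards1 expr1.
  by rewrite -!natrM ler_nat; apply: leq_trans hdK; rewrite !leq_mul.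
have [] := @popular_coordinates R I m m_gt0 h l L label G (T :|: \bigcup_j S j) g t c
  G01 g0 mc cm _ _ hcL.
- move=> j; have t8 : 0 < 8 ^+ t :> R by rewrite exprn_gt0.
  have : delta * 8 ^+ t < (2 * mean (G j)) * 8 ^+ t.
    by rewrite ltr_pM2r //; apply: lt_le_trans (FG j).
  rewrite -mulrA => /(le_lt_trans d8); rewrite ltr_pM2l //.
- apply: leq_ltn_trans room; rewrite !leq_add2r; apply: leq_trans (leq_card_setU _ _) _.
  rewrite leq_add2l; apply: leq_trans (card_bigcup_le _ _) _.
  by rewrite -[h in leqRHS]card_ord -sum_nat_const; apply: leq_sum => j _; exact: Sd.
move=> Phi [phi [z [Phi_inj PhiX phi_inj zP meanP]]].
set Q := [set Phi k | k : 'I_l] in meanP.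
have PhiT k : Phi k \notin T by have := PhiX k; rewrite inE negb_or => /andP[].
have PhiS k j : Phi k \notin S j.
  by apply: contra (PhiX k) => kS; rewrite inE; apply/orP; right; apply/bigcupP; exists j.
pose G' j := freeze Q (z j) (G j).
have l16 : 0 < 2 * 16 ^+ l :> R by rewrite mulr_gt0 // exprn_gt0.
have FG' j : mean (Ff j) <= 2 * 16 ^+ l * mean (G' j).
  apply: le_trans (FG j) _; rewrite -mulrA ler_wpM2l //; exact: meanP.
have G'0 j : 0 < mean (G' j).
  by rewrite -(pmulr_rgt0 _ l16) (lt_le_trans _ (FG' j)) // (lt_trans delta0).
(* For nonempty [Q'] one has |Q'| + l <= |Q'| (l + 1), which accounts for the planted coordinates,
   and one factor 2 * 16^l per coordinate covers the lost density. *)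
set K' : R := (2 * 16 ^ l * K ^ l.+1)%:R.
have K'E : K' = 2 * 16 ^+ l * K%:R ^+ l.+1 by rewrite /K' !natrM !natrX.
have K'1 : 1 <= K' by rewrite ler1n !muln_gt0 !expn_gt0 K0.
have G'spread j (Q' : {set I}) x : av (~: Q') (G' j) x <= K' ^+ #|Q'| * mean (G' j).
  have [->|Qn0] := eqVneq Q' set0; first by rewrite cards0 expr0 mul1r setC0 avT.
  rewrite av_freeze; apply: le_trans (av_le (g := Ff j) _ _ _) _.
    move=> y; have /andP[F0 F1] := F01 j y; have /andP[a0 a1] := h0 (avoids (E j) y).
    by rewrite ler_piMr.
  apply: le_trans (Fspread _ _ _) _.
  apply: le_trans (ler_wpM2l (exprn_ge0 _ (ler0n _ _)) (FG' j)) _.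
  rewrite mulrA ler_wpM2r ?(ltW (G'0 j)) // K'E exprMn mulrC.
  have n0 : (0 < #|Q'|)%N by rewrite card_gt0.
  rewrite -exprM; apply: ler_pM; rewrite ?(ltW l16) ?exprn_ge0 ?ler0n //.
    rewrite -{1}[2 * 16 ^+ l]expr1 ler_weXn2l // -[1]mulr1 ler_pM //; first by lra.
    by apply: exprn_ege1; lra.
  apply: ler_weXn2l => //; apply: leq_trans (leq_card_setU _ _) _.
  apply: (@leq_trans (#|Q'| + l)).
    by rewrite leq_add2l (leq_trans (leq_imset_card _ _)) // (leq_trans (max_card _)) // card_ord.
  by rewrite mulSn leq_add2l leq_pmulr.
have muw j : 1 <= mean (G' j) * (2 * w%:R) ^+ p.+2.
  have W0 : 0 <= (2 * w%:R : R) ^+ p.+2 by rewrite exprn_ge0 // mulr_ge0 ?ler0n.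
  rewrite -(ler_pM2l l16) mulr1 mulrA; apply: le_trans dw _; rewrite ler_wpM2r //.
  by apply: ltW; exact: lt_le_trans (FG' j).
have K'w : K' <= w%:R by rewrite ler_nat.
have G'01 j y : 0 <= G' j y <= 1 by exact: G01.
have [x [xG xdis]] := spread_disagreeing m_gt0 C0 expansion wbig mw mw' K'1 K'w
  G'01 G'0 G'spread muw.
(* The freezes are undone from the inside: planted values first, then the values of the
   restriction. *)
pose wj j := overwrite Q (x j) (z j); pose y j := overwrite (S j) (wj j) (al j).
have GwP j : [/\ y j \in B j, avoids (D j u) (y j) & avoids (E j) (wj j)].
  have := xG j; rewrite /G' /freeze -/(wj j) /G mulf_eq0 negb_or.
  rewrite /Ff /F /freeze -/(y j) /f !pnatr_eq0 !eqb0 !negbK.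
  by case/andP=> /andP[].
have yS j i : i \in S j -> y j i = al j i by move=> iS; rewrite ffunE iS.
have ynS j i : i \notin S j -> y j i = wj j i by move=> iS; rewrite ffunE (negPf iS).
have order (j j' : 'I_h) i : (j' < j)%N -> i \notin T -> i \in S j -> i \in S j' -> y j i != y j' i.
  move=> jj' iT iS iS'; rewrite (yS j') //; have [_ aD _] := GwP j.
  by apply: avoids_dictators (avoids_bigcup aD jj') _; rewrite !inE iT.
(* Two restricted coordinates are separated by the family chosen later, a restricted and a free one
   by [E]. *)
have Sdis j j' i : j != j' -> i \notin T -> i \in S j -> y j i != y j' i.
  move=> jj' iT iS; case: (boolP (i \in S j')) => iS'.
    have [lt|lt|/val_inj E'] := ltngtP j j'; last by rewrite E' eqxx in jj'.
      by rewrite eq_sym order.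
    exact: order.
  rewrite (yS j) // ynS // eq_sym; have [_ _ aE] := GwP j'.
  exact: avoids_dictators (avoids_bigcup aE jj') iS.
exists y, Phi; split=> // [j|j j' jj' i iT]; first by case: (GwP j).
have [iS|iS] := boolP (i \in S j).
  rewrite (negPf (Sdis _ _ _ jj' iT iS)); apply/esym/existsP => -[k /andP[/eqP ik _]].
  by have := PhiS k j; rewrite -ik iS.
have [iS'|iS'] := boolP (i \in S j').
  rewrite eq_sym in jj'; rewrite eq_sym (negPf (Sdis _ _ _ jj' iT iS')).
  apply/esym/existsP => -[k /andP[/eqP ik _]].
  by have := PhiS k j'; rewrite -ik iS'.
rewrite !ynS // /wj !ffunE.
have [/imsetP[k _ ->]|iQ] := boolP (i \in Q).
  rewrite !zP (inj_eq (@phi_inj k)); apply/idP/existsP => [/eqP E'|[k' /andP[/eqP/Phi_inj -> //]]].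
  by exists k; rewrite eqxx E' eqxx.
rewrite (negPf (xdis _ _ jj' i)); apply/esym/existsP => -[k /andP[/eqP ik _]].
by rewrite ik imset_f in iQ.
Qed.

End Realisation.

(** * Cylinders and the theorem *)

Section Cylinders.
Variables (n m : nat) (S : {set 'I_n}).
Hypothesis m_gt0 : (0 < m)%N.
Local Notation sub := {i : 'I_n | i \notin S}.

(** The families have different index sets; their cylinders live in one cube and keep their
    measure. *)
Definition project (x : {ffun 'I_n -> 'I_m}) : {ffun sub -> 'I_m} := [ffun i => x (val i)].

Lemma mean_cylinder (A : {set {ffun sub -> 'I_m}}) :
  mean (fun x => (project x \in A)%:R : rat) = mu A.
Proof.
have E1 u : mean (fun x => (project x == u)%:R : rat) = m%:R^-1 ^+ #|{: sub}|.
  pose phi (i : 'I_n) (a : 'I_m) : rat := if insub i is Some i' then (a == u i')%:R else 1.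
  have -> : (fun x => (project x == u)%:R : rat) = (fun x => \prod_i phi i (x i)).
    apply: functional_extensionality => x; case: eqP => [xu|ne].
      rewrite big1 // => i _; rewrite /phi; case: insubP => // i' _ <-.
      by rewrite -xu ffunE eqxx.
    have /existsP[i' ne'] : [exists i, project x i != u i].
      rewrite -negb_forall; apply/negP => /forallP H; apply: ne.
      by apply/ffunP => i; apply/eqP.
    rewrite (bigD1 (val i')) //= /phi valK; move: ne'; rewrite ffunE => /negPf ->.
    by rewrite mul0r.
  rewrite mean_prod (bigID [pred i | i \in S]) /= big1 ?mul1r; last first.
    move=> i iS; rewrite /phi insubF ?iS // sumr_const card_ord mulVf //.
    by rewrite pnatr_eq0 -lt0n.
  rewrite (eq_bigr (fun=> m%:R^-1)) => [|i iS]; last first.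
    rewrite /phi insubT; set i' := Sub _ _.
    by rewrite (bigD1 (u i')) //= eqxx big1 ?addr0 ?mulr1 // => a /negPf ->.
  by rewrite prodr_const card_sig; congr (_ ^+ _); apply: eq_card => i; rewrite !inE.
have -> : (fun x => (project x \in A)%:R : rat) =
    (fun x => \sum_(u : {ffun sub -> 'I_m}) (u \in A)%:R * (project x == u)%:R).
  apply: functional_extensionality => x; rewrite (bigD1 (project x)) //= eqxx mulr1.
  by rewrite big1 ?addr0 // => u; rewrite eq_sym => /negPf ->; rewrite mulr0.
rewrite mean_bigsum; under eq_bigr => u _ do rewrite meanZ E1.
by rewrite -mulr_suml -natr_sum -big_mkcond sum1_card /mu exprVn.
Qed.

Lemma uncapturable_mean (r : nat) (eps : rat) (A : {set {ffun sub -> 'I_m}})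
    (D : {set 'I_n * 'I_m}) :
  uncapturable r eps A -> (#|D| <= r)%N -> (forall q, q \in D -> q.1 \notin S) ->
  eps < mean (fun x => ((x \in [set x | project x \in A]) && avoids D x)%:R : rat).
Proof.
move=> unc Dr DS; pose D' := [set q : sub * 'I_m | (val q.1, q.2) \in D].
have D'r : (#|D'| <= r)%N.
  apply: leq_trans Dr; rewrite -(card_imset _ (f := fun q : sub * 'I_m => (val q.1, q.2))).
    by apply: subset_leq_card; apply/subsetP => q /imsetP[q' + ->]; rewrite inE.
  by move=> [i a] [j b] /= [/val_inj -> ->].
apply: lt_le_trans (unc D' D'r) _; rewrite -mean_cylinder; apply: mean_le => x.
rewrite ler_nat !inE andbC; case: (project x \in A) => //=.
case: (boolP (project x \in _)) => //= ndict.
rewrite lt0b; apply/forall_inP => q qD; apply: contraNneq ndict => xq.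
apply/bigcupP; exists (exist _ q.1 (DS q qD), q.2); first by rewrite inE /= -surjective_pairing.
by rewrite inE /= ffunE /= xq.
Qed.

End Cylinders.

(** * Edges as vectors of labels *)

Section Labels.
Variables (l h : nat) (V : finType) (part : V -> 'I_l) (e : 'I_h -> {set V}).

(** [option V] avoids the need for a default vertex; in a configuration the value is never
    [None]. *)
Definition edge_vertex (j : 'I_h) (k : 'I_l) : option V := [pick v in e j | part v == k].

Lemma edge_vertex_eq j j' k : is_config part e ->
  (edge_vertex j k == edge_vertex j' k) =
  ([set v in e j :&: e j' | part v == k] != set0).
Proof.
move=> conf.
have uniq1 i v v' : v \in e i -> part v == k -> v' \in e i -> part v' == k -> v = v'.
  have /eqP/cards1P[v0 E] := conf i k => vi vk vi' vk'.
  have : v \in [set v in e i | part v == k] by rewrite inE vi.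
  have : v' \in [set v in e i | part v == k] by rewrite inE vi'.
  by rewrite E !inE => /eqP -> /eqP ->.
have some i : exists2 v, edge_vertex i k = Some v & (v \in e i) && (part v == k).
  rewrite /edge_vertex; case: pickP => [v|none]; first by exists v.
  by have := conf i k; rewrite (eq_card0 (A := [set _ in _ | _])) // => v; rewrite inE; exact: none.
have [v -> /andP[vj vk]] := some j; have [v' -> /andP[vj' vk']] := some j'.
apply/eqP/set0Pn => [[vv']|[v0]]; first by exists v; rewrite !inE vj vk vv' vj'.
rewrite !inE => /andP[/andP[v0j v0j'] v0k].
by rewrite (uniq1 j v v0) // (uniq1 j' v' v0).
Qed.

End Labels.

(** * Choice of constants and conclusion *)

Theorem theorem8p4 :
  forall (l h : nat) (V : finType) (part : V -> 'I_l) (e : 'I_h -> {set V}),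
  is_config part e ->
  forall s k : nat,
  exists r m0 N : nat,
  forall m n : nat, (m0 <= m)%N ->
  Rdefinitions.Rle (Rdefinitions.Rmult (Raxioms.INR N) (Rpower.ln (Raxioms.INR m)))
                   (Raxioms.INR n) ->
  forall (R : 'I_h -> {set 'I_n})
         (A : forall j : 'I_h, {set {ffun {i : 'I_n | i \notin R j} -> 'I_m}}),
  (forall j, (#|R j| <= k)%N) ->
  (forall j, uncapturable r ((m%:R : rat) ^- k) (A j)) ->
  exists x : forall j : 'I_h, {ffun {i : 'I_n | i \notin R j} -> 'I_m},
    (forall j, x j \in A j) /\
    realise part e
      (fun j => restr (R_sub_T R j) (x j)).
Proof.
move=> l h V part e conf s k.
(* p + 2 = 4(k+1), so (2w)^(p+2) = (16 w^4)^(k+1) >= m^(k+1): at density m^-k the loss stays below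
   2w. *)
pose p := (4 * k + 2)%N.
have [C C0 expansion] := power_expansion_le rat p.+1.
(* K^d >= m^k limits the size of a restriction; [g] gives h c <= m/2, so half the alphabet is left
   for labels. *)
pose d := (8 * l.+1 * k)%N; pose g := (4 * h.+1)%N.
(* The first summand serves the second moment; the second gives 2 h d K <= w^2 <= m. *)
pose w0 := (128 * C ^ 2 * h.+1 ^ 2 + 2 * (h * d))%N.
pose m0 := (w0.+1 ^ 4 + (2 * 16 ^ l) ^ 8 * 2 ^ (8 * l.+1) + 2 * 16 ^ l + 2 * #|V| + 3)%N.
pose N := (h * k + h * d + l + h * (8 * g * k.+1) + 1)%N.
(* At most [h * d] values are fixed by all the restrictions together; the 4 converts natural into
   binary logarithms. *)
exists (h * d)%N, m0, (4 * N)%N => m n mbig nbig R A Rk unc.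
have m3 : (2 < m)%N by apply: leq_trans mbig; rewrite /m0; lia.
have m_gt0 : (0 < m)%N by lia.
have nN := up_log_le_of_ln m3 nbig; set t0 := up_log 2 m in nN.
have mt0 : (m <= 2 ^ t0)%N by exact: up_logP.
have t01 : (0 < t0)%N by rewrite lt0n; apply: contraTneq mt0 => ->; rewrite -ltnNge ltnW.
have m_w0 : (w0.+1 ^ 4 <= m)%N by apply: leq_trans mbig; rewrite /m0; lia.
have m_root : ((2 * 16 ^ l) ^ 8 * 2 ^ (8 * l.+1) <= m)%N by apply: leq_trans mbig; rewrite /m0; lia.
have m_l : (2 * 16 ^ l <= m)%N by apply: leq_trans mbig; rewrite /m0; lia.
have m_V : (2 * #|V| + 3 <= m)%N by apply: leq_trans mbig; rewrite /m0; lia.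
clearbody m0; clear mbig m0.
have [w [w0w mw mw1 mw']] := fourth_root_bounds m_w0.
have [K [K0 mK Kw]] := root_choice (ltnW m3) mw1 m_root.
have wbig : (128 * C ^ 2 * h.+1 ^ 2 < w)%N by apply: leq_ltn_trans w0w; rewrite leq_addr.
have hdw : (2 * (h * d) <= w)%N.
  by apply: leq_trans (ltnW w0w); rewrite leq_addl.
have w_gt0 : (0 < w)%N by apply: leq_ltn_trans w0w.
have hdK : (2 * (h * d) * K <= m)%N.
  have KX : (K <= 2 * 16 ^ l * K ^ l.+1)%N.
    rewrite expnS mulnCA leq_pmulr // !muln_gt0 !expn_gt0 K0 //.
  apply: leq_trans (leq_mul hdw (leq_trans KX Kw)) _; apply: leq_trans mw.
  by rewrite -[X in (X <= _)%N]/(w ^ 2)%N leq_pexp2l.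
(* The ceiling of m / g. *)
pose c := (m.-1 %/ g).+1.
have g0 : (0 < g)%N by rewrite muln_gt0.
have mgc : (m <= g * c)%N.
  by have := ltn_ceil m.-1 g0; rewrite -/c mulnC; lia.
have gm : (g <= m)%N.
  have : (128 * 1 * h.+1 <= w)%N.
    apply: leq_trans (ltnW wbig); rewrite leq_mul //.
      by rewrite leq_mul // expn_gt0 C0.
    by rewrite -{1}[h.+1]expn1 leq_pexp2l.
  have : (w <= m)%N by apply: leq_trans mw; rewrite -{1}[w]expn1 leq_pexp2l.
  by rewrite /g; lia.
have cm : (g * c <= 2 * m)%N.
  by rewrite /c mulnS; have := leq_divM m.-1 g; rewrite mulnC; lia.
have hcL : (h * c + #|{: option V}| <= m)%N.
  rewrite card_option; have : (4 * (h * c) <= g * c)%N by rewrite /g !mulnA leq_mul2r leq_mul2l leqnSn !orbT.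
  by lia.
pose T := \bigcup_(j0 : 'I_h) R j0.
have cardT : (#|T| <= h * k)%N.
  apply: leq_trans (card_bigcup_le _ _) _.
  by rewrite -[h in leqRHS]card_ord -sum_nat_const; apply: leq_sum => j _; exact: Rk.
have room : (#|T| + h * d + l + h * (8 * g * (k.+1 * t0)) < #|'I_n|)%N.
  rewrite card_ord; apply: leq_trans nN.
  apply: (@leq_ltn_trans ((h * k + h * d + l + h * (8 * g * k.+1)) * t0)); last first.
    by rewrite ltn_pmul2r // /N addn1.
  rewrite mulnDl -!mulnA leq_add2r; apply: (@leq_trans (h * k + h * d + l)).
    by rewrite !leq_add2r.
  by rewrite leq_pmulr.
have mR : 0 < m%:R :> rat by rewrite ltr0n.
have mkR : 0 < m%:R ^+ k :> rat by rewrite exprn_gt0.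
pose delta : rat := m%:R ^- k.
have delta0 : 0 < delta by rewrite invr_gt0.
(* The spare factor [m] beyond m^k pays for 2 * 16^l. *)
have deltaP (X : rat) : m%:R ^+ k.+1 <= X -> 2 * 16 ^+ l <= delta * X.
  move=> mX; apply: le_trans (ler_wpM2l (ltW delta0) mX).
  by rewrite exprS mulrCA mulVf ?gt_eqF // mulr1 -natrX -natrM ler_nat.
have Kd : 1 <= K%:R ^+ d.+1 * delta.
  rewrite ler_pdivlMr // mul1r -!natrX ler_nat; apply: (@leq_trans (K ^ d)).
    by rewrite /d expnM; case: (posnP k) => [->|k0]; rewrite ?expn0 ?leq_exp2r.
  by rewrite leq_pexp2l.
have d8 : 2 * 16 ^+ l <= delta * 8 ^+ (k.+1 * t0).
  apply: deltaP; rewrite -!natrX ler_nat [(k.+1 * t0)%N]mulnC expnM leq_exp2r //.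
  by apply: leq_trans mt0 _; rewrite leq_exp2r.
have dw : 2 * 16 ^+ l <= delta * (2 * w%:R) ^+ p.+2.
  apply: deltaP; rewrite (_ : p.+2 = 4 * k.+1)%N; last by rewrite /p; lia.
  by rewrite exprM -natrM -!natrX ler_nat leq_exp2r // expnMn.
have H j (D : {set 'I_n * 'I_m}) : (#|D| <= h * d)%N -> (forall q, q \in D -> q.1 \notin T) ->
    delta < mean (fun x => ((x \in [set x | project (R j) x \in A j]) && avoids D x)%:R : rat).
  move=> Dr DT; apply: (uncapturable_mean m_gt0 (unc j) Dr) => q /DT.
  exact/notin_sub/R_sub_T.
have [y [Phi [Phi_inj PhiT yB yP]]] := cube_realisation m_gt0 (edge_vertex part e)
  C0 expansion wbig mw mw' K0 Kw hdK delta0 Kd g0 mgc cm d8 room hcL dw H.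
exists (fun j => project (R j) (y j)); split=> [j|]; first by have := yB j; rewrite inE.
exists (fun k => exist _ (Phi k) (PhiT k)); split=> [k1 k2 [/Phi_inj //]|j j' jj' i].
rewrite !ffunE /= (yP j j' jj' _ (valP i)); apply: eq_existsb => k1.
by rewrite -val_eqE /= edge_vertex_eq.
Qed.
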